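(* Let $n\geq 2$, let $F:\mathbb{D}\longrightarrow\Omega_n$ be a holomorphic map, and let $\zeta_1,\zeta_2\in\mathbb{D}$. Write $W_j=F(\zeta_j)$, $j=1,2$. Let $\sigma(W_j)$ denote the set of eigenvalues of $W_j$ (elements of $\sigma(W_j)$ are not repeated according to multiplicity), and for $\lambda\in\sigma(W_j)$ let $m_j(\lambda)$ denote the multiplicity of $\lambda$ as a zero of the minimal polynomial of $W_j$, $j=1,2$. Then $$\max\left\{\max_{\mu\in\sigma(W_2)}\ \prod_{\lambda\in\sigma(W_1)}\mathcal{M}_{\mathbb{D}}(\mu,\lambda)^{m_1(\lambda)},\ \ \max_{\lambda\in\sigma(W_1)}\ \prod_{\mu\in\sigma(W_2)}\mathcal{M}_{\mathbb{D}}(\lambda,\mu)^{m_2(\mu)}\right\}\ \leq\ \left|\frac{\zeta_1-\zeta_2}{1-\overline{\zeta_2}\,\zeta_1}\right|.$$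
   Context: $\mathbb{D}$ is the open unit disc in $\mathbb{C}$ centered at $0$. $M_n(\mathbb{C})$ is the space of $n\times n$ complex matrices, $r(W)$ is the spectral radius of $W$, and $\Omega_n:=\{W\in M_n(\mathbb{C}): r(W)<1\}$ is the spectral unit ball, viewed as an open subset of $\mathbb{C}^{n^2}$. The pseudohyperbolic distance on $\mathbb{D}$ is $$\mathcal{M}_{\mathbb{D}}(z_1,z_2):=\left|\frac{z_1-z_2}{1-\overline{z_2}\,z_1}\right|,\qquad z_1,z_2\in\mathbb{D}.$$ *)

(* Defs.v *)
From mathcomp Require Import all_boot all_order all_algebra.
From mathcomp Require Import finmap.
From mathcomp Require Import all_classical all_reals all_analysis.
From mathcomp Require Import complex.

Set Implicit Arguments.
Unset Strict Implicit.
Unset Printing Implicit Defensive.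

Import Order.TTheory GRing.Theory Num.Theory.
Import numFieldNormedType.Exports.
Import ComplexField.Normc.

Local Open Scope classical_set_scope.
Local Open Scope ring_scope.

(* On [R[i]] the library norm [`|z|] has values in [R[i]] itself; [normc z] is
   the same modulus as an element of [R]. *)

Definition unit_disc (R : realType) : set R[i] := [set z | normc z < 1].

Definition pseudohyp (R : realType) (z1 z2 : R[i]) : R :=
  normc ((z1 - z2) / (1 - (z2^*)%C * z1)).

(* Stated over an abstract [numFieldType] because that is where the library
   attaches its norm topology. For [C := R[i]], [derivable F z 1] says that
   (F (z + h) - F z) / h converges as the complex number h != 0 tends to 0. *)
Definition holomorphic_on (C : numFieldType) (n : nat) (D : set C)
    (F : C -> 'M[C]_n.+1) : Prop :=
  forall z, D z -> derivable F z 1.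

(* The set of eigenvalues, without repetition. [fset_set] is [fset0] on infinite
   sets; [mem_spectrum] shows that this case does not occur. *)
Definition spectrum (K : fieldType) (n : nat) (W : 'M[K]_n) : {fset K} :=
  fset_set [set a | eigenvalue W a].

Lemma finite_eigenvalues (K : fieldType) (n : nat) (W : 'M[K]_n) :
  finite_set [set a | eigenvalue W a].
Proof.
have p0 : char_poly W != 0 by rewrite monic_neq0 ?char_poly_monic.
apply: contrapT => inf.
have [A Asub Acard] := infinite_set_fset (size (char_poly W)) inf.
have: (size A < size (char_poly W))%N.
  apply: max_poly_roots => //; last exact: fset_uniq.
  by apply/allP => x /Asub /=; rewrite eigenvalue_root_char.
by rewrite ltnNge Acard.
Qed.

Lemma mem_spectrum (K : fieldType) (n : nat) (W : 'M[K]_n) (a : K) :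
  (a \in spectrum W) = eigenvalue W a.
Proof.
rewrite /spectrum in_fset_set; last exact: finite_eigenvalues.
by apply/idP/idP; rewrite inE.
Qed.

(* The starting value 0 of a maximum of nonnegative terms over a spectrum is
   harmless: over [R[i]] the spectrum of a nonempty square matrix is nonempty. *)
Definition spectral_radius (R : realType) (n : nat) (W : 'M[R[i]]_n) : R :=
  \big[Num.max/0]_(a <- spectrum W) normc a.

Definition spectral_ball (R : realType) (n : nat) : set 'M[R[i]]_n :=
  [set W | spectral_radius W < 1].

Definition minpoly_mult (K : fieldType) (n : nat) (W : 'M[K]_n.+1) (a : K) :
    nat :=
  mup a (mxminpoly W).

(* Main.v *)
Require Import Defs.
From mathcomp Require Import all_boot all_order all_algebra.
From mathcomp Require Import finmap.
From mathcomp Require Import all_classical all_reals all_analysis.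
From mathcomp Require Import complex ring lra.
Import Order.TTheory GRing.Theory Num.Theory.
Import numFieldNormedType.Exports.
Import ComplexField.Normc.
Local Open Scope classical_set_scope.
Local Open Scope ring_scope.
Local Notation Re := complex.Re.
Local Notation Im := complex.Im.

Set Implicit Arguments.
Unset Strict Implicit.
Unset Printing Implicit Defensive.

(** Let [B] be the finite Blaschke product whose zeros are the eigenvalues of
    [W1 = F zeta1], with the multiplicities of the minimal polynomial of [W1].
    Then [B] annihilates [W1], so [H z := B (F z)] is a holomorphic matrix
    function on the disc with [H zeta1 = 0], and its eigenvalues at [z] are
    the numbers [B mu] for [mu] an eigenvalue of [F z], of modulus at most 1. The
    claim is the Schwarz lemma [r (H zeta2) <= pseudohyp zeta2 zeta1] for the
    spectral radius [r] ([blaschke_schwarz]); the other half of the maximum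
    follows by exchanging the two points.

    The Schwarz lemma is reduced to scalar functions by taking traces. The
    function [tr (H ^+ k.+1)] is holomorphic, bounded by the size of the
    matrices, and vanishes at [zeta1] to order at least [k + 1]. Dividing it by
    the power [k] of the disc automorphism that vanishes at [zeta1] leaves a
    function that is continuous and zero at [zeta1] and holomorphic elsewhere,
    and the maximum modulus principle bounds it ([trace_schwarz]). The resulting
    geometric bounds on all power sums of the eigenvalues of [H zeta2] bound
    each eigenvalue ([power_sums_bound]). Eigenvalues and traces of [H z] are
    read off from simultaneous triangularizations ([commuting_spectra]).

    The maximum modulus principle ([maximum_modulus]) assumes differentiability
    only, not continuity of the derivative. It rests on a mean value bound over
    circles ([mean_value_bound]), obtained from Goursat's theorem on rectangles
    ([goursat]) by composing with the exponential, for which a circle is the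
    image of a vertical segment of length [2 pi]. *)

(** * Differentiability of matrix-valued functions *)

Section Differentiability.
Variable C : numFieldType.
Implicit Types (f g : C -> C) (z : C).

(** Differentiability of a [C]-valued function of one variable in [C]; at
    [C := R[i]] this is complex differentiability. *)
Definition cdifferentiable f z : Prop := derivable f z 1.

Lemma cdifferentiable_approx f z : cdifferentiable f z ->
  forall e, 0 < e -> exists2 dl, 0 < dl & forall w, `|w - z| < dl ->
    `|f w - f z - 'D_1 f z * (w - z)| <= e * `|w - z|.
Proof.
move=> df e e0.
have : h^-1 *: (f (h *: 1 + z) - f z) @[h --> 0^'] --> 'D_1 f z.
  exact: df.
move=> /cvgrPdist_le /(_ e e0).
rewrite near_withinE => /nbhs_ballP[dl /= dl0 H].
exists dl => // w wz; have [->|nwz] := eqVneq w z.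
  by rewrite !subrr mulr0 subr0 normr0 mulr0.
have wz0 : w - z != 0 by rewrite subr_eq0.
have := H (w - z); rewrite /ball /= sub0r normrN => /(_ wz wz0).
rewrite /= scaler1 subrK /GRing.scale /= => K.
have -> : f w - f z - 'D_1 f z * (w - z) =
   ((w - z)^-1 * (f w - f z) - 'D_1 f z) * (w - z).
  by rewrite mulrBl mulrAC mulVf ?mul1r.
by rewrite normrM ler_wpM2r // distrC.
Qed.

Lemma cdifferentiable_cst (a : C) z : cdifferentiable (fun=> a) z.
Proof. exact: derivable_cst. Qed.

Lemma cdifferentiable_id z : cdifferentiable id z.
Proof. exact: derivable_id. Qed.

Lemma cdifferentiableD f g z : cdifferentiable f z -> cdifferentiable g z ->
  cdifferentiable (fun w => f w + g w) z.
Proof. exact: derivableD. Qed.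

Lemma cdifferentiableB f g z : cdifferentiable f z -> cdifferentiable g z ->
  cdifferentiable (fun w => f w - g w) z.
Proof. exact: derivableB. Qed.

Lemma cdifferentiableM f g z : cdifferentiable f z -> cdifferentiable g z ->
  cdifferentiable (fun w => f w * g w) z.
Proof. exact: derivableM. Qed.

Lemma cdifferentiableV f z : f z != 0 -> cdifferentiable f z ->
  cdifferentiable (fun w => (f w)^-1) z.
Proof. exact: derivableV. Qed.

Lemma cdifferentiableX f z k : cdifferentiable f z ->
  cdifferentiable (fun w => f w ^+ k) z.
Proof.
move=> df; elim: k => [|k IH].
  by under eq_fun do rewrite expr0; exact: cdifferentiable_cst.
by under eq_fun do rewrite exprS; exact: cdifferentiableM.
Qed.

Lemma cdifferentiable_sum (I : Type) (r : seq I) (P : pred I)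
    (F : I -> C -> C) z :
  (forall i, cdifferentiable (F i) z) ->
  cdifferentiable (fun w => \sum_(i <- r | P i) F i w) z.
Proof.
move=> dF; elim: r => [|i r IH].
  by under eq_fun do rewrite big_nil; exact: cdifferentiable_cst.
under eq_fun do rewrite big_cons; case: (P i) => //.
exact: cdifferentiableD.
Qed.

Lemma cdifferentiable_prod (I : Type) (r : seq I) (P : pred I)
    (F : I -> C -> C) z :
  (forall i, cdifferentiable (F i) z) ->
  cdifferentiable (fun w => \prod_(i <- r | P i) F i w) z.
Proof.
move=> dF; elim: r => [|i r IH].
  by under eq_fun do rewrite big_nil; exact: cdifferentiable_cst.
under eq_fun do rewrite big_cons; case: (P i) => //.
exact: cdifferentiableM.
Qed.

(** Entrywise differentiability of a matrix-valued function. *)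
Definition mxdifferentiable m n (F : C -> 'M[C]_(m, n)) z :=
  forall i j, cdifferentiable (fun w => F w i j) z.

Lemma derivable_mxdifferentiable m n (F : C -> 'M[C]_(m.+1, n.+1)) z :
  derivable F z 1 -> mxdifferentiable F z.
Proof.
move=> /derivable1_diffP dF i j; apply/derivable1_diffP.
apply: (@differentiable_comp _ _ _ _ F
  (fun M : 'M[C]_(m.+1, n.+1) => M i j)) => //.
exact: differentiable_coord.
Qed.

Lemma mxdifferentiable_cst m n (A : 'M[C]_(m, n)) z :
  mxdifferentiable (fun=> A) z.
Proof. by move=> i j; exact: cdifferentiable_cst. Qed.

Lemma mxdifferentiableM m n p (F : C -> 'M[C]_(m, n))
    (G : C -> 'M[C]_(n, p)) z :
  mxdifferentiable F z -> mxdifferentiable G z ->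
  mxdifferentiable (fun w => F w *m G w) z.
Proof.
move=> dF dG i j; under eq_fun do rewrite mxE.
by apply: cdifferentiable_sum => k; exact: cdifferentiableM.
Qed.

Lemma mxdifferentiableD m n (F G : C -> 'M[C]_(m, n)) z :
  mxdifferentiable F z -> mxdifferentiable G z ->
  mxdifferentiable (fun w => F w + G w) z.
Proof.
by move=> dF dG i j; under eq_fun do rewrite mxE; exact: cdifferentiableD.
Qed.

Lemma mxdifferentiableX n (F : C -> 'M[C]_n.+1) k z :
  mxdifferentiable F z -> mxdifferentiable (fun w => F w ^+ k) z.
Proof.
move=> dF; elim: k => [|k IH].
  by under eq_fun do rewrite expr0; exact: mxdifferentiable_cst.
by under eq_fun do rewrite exprS; exact: mxdifferentiableM.
Qed.

Lemma mxdifferentiable_horner n (F : C -> 'M[C]_n.+1) (p : {poly C}) z :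
  mxdifferentiable F z -> mxdifferentiable (fun w => horner_mx (F w) p) z.
Proof.
move=> dF; elim/poly_ind: p => [|p c IH].
  by under eq_fun do rewrite rmorph0; exact: mxdifferentiable_cst.
under eq_fun do rewrite rmorphD rmorphM /= horner_mx_X horner_mx_C.
apply: mxdifferentiableD; last exact: mxdifferentiable_cst.
exact: mxdifferentiableM.
Qed.

Lemma cdifferentiable_det n (F : C -> 'M[C]_n) z :
  mxdifferentiable F z -> cdifferentiable (fun w => \det (F w)) z.
Proof.
move=> dF; apply: cdifferentiable_sum => s.
apply: cdifferentiableM; first exact: cdifferentiable_cst.
by apply: cdifferentiable_prod => i; exact: dF.
Qed.

Lemma mxdifferentiable_adj n (F : C -> 'M[C]_n) z :
  mxdifferentiable F z -> mxdifferentiable (fun w => \adj (F w)) z.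
Proof.
move=> dF i j; under eq_fun do rewrite mxE.
apply: cdifferentiableM; first exact: cdifferentiable_cst.
apply: cdifferentiable_det => k l.
by under eq_fun do rewrite !mxE; exact: dF.
Qed.

Lemma cdifferentiable_tr n (F : C -> 'M[C]_n) z :
  mxdifferentiable F z -> cdifferentiable (fun w => \tr (F w)) z.
Proof. by move=> dF; apply: cdifferentiable_sum => i; exact: dF. Qed.

End Differentiability.

(** * The modulus and complex differentiability in epsilon-delta form *)

Section Modulus.
Variable R : realType.
Implicit Types x y z : R[i].

Lemma normc_normr z : (normc z)%:C%C = `|z|. Proof. by []. Qed.

Lemma normc_ge0 z : 0 <= normc z.
Proof. by case: z => a b; exact: sqrtr_ge0. Qed.

Lemma normcN z : normc (- z) = normc z.
Proof. by apply: complexI; rewrite !normc_normr normrN. Qed.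

Lemma normc_distC x y : normc (x - y) = normc (y - x).
Proof. by rewrite -normcN opprB. Qed.

Lemma ler_normcD x y : normc (x + y) <= normc x + normc y.
Proof. by rewrite -lecR raddfD /= !normc_normr ler_normD. Qed.

Lemma normc_gt0 z : (0 < normc z) = (z != 0).
Proof. by rewrite -ltcR normc_normr normr_gt0. Qed.

Lemma normc_eq0 z : (normc z == 0) = (z == 0).
Proof. by apply/eqP/eqP => [/eq0_normc//|->]; exact: normc0. Qed.

Lemma normcX z k : normc (z ^+ k) = normc z ^+ k.
Proof. by apply: complexI; rewrite rmorphXn /= !normc_normr normrX. Qed.

Lemma normcJ z : normc (z^*)%C = normc z.
Proof. by case: z => a b /=; rewrite sqrrN. Qed.

Lemma normc_real (a : R) : normc (a%:C)%C = `|a|.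
Proof. by rewrite /= expr0n addr0 sqrtr_sqr. Qed.

Lemma normc_sqr z : normc z ^+ 2 = Re z ^+ 2 + Im z ^+ 2.
Proof. by case: z => a b; rewrite sqr_sqrtr //= addr_ge0 ?sqr_ge0. Qed.

Lemma ler_Re_normc z : `|Re z| <= normc z.
Proof.
rewrite -(@ler_pXn2r _ 2) ?nnegrE ?normc_ge0// normc_sqr.
by rewrite real_normK ?num_real// lerDl sqr_ge0.
Qed.

Lemma ler_Im_normc z : `|Im z| <= normc z.
Proof.
rewrite -(@ler_pXn2r _ 2) ?nnegrE ?normc_ge0// normc_sqr.
by rewrite real_normK ?num_real// lerDr sqr_ge0.
Qed.

Lemma ler_normc_ReIm z : normc z <= `|Re z| + `|Im z|.
Proof.
rewrite -(@ler_pXn2r _ 2) ?nnegrE ?normc_ge0 ?addr_ge0// normc_sqr sqrrD.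
by rewrite !real_normK ?num_real// lerD2r lerDl mulrn_wge0 ?mulr_ge0.
Qed.

Lemma ReM x y : Re (x * y) = Re x * Re y - Im x * Im y.
Proof. by case: x y => a b [c d]. Qed.

Lemma ImM x y : Im (x * y) = Re x * Im y + Im x * Re y.
Proof. by case: x y => a b [c d]. Qed.

Lemma ReD x y : Re (x + y) = Re x + Re y.
Proof. by case: x y => a b [c d]. Qed.

Lemma ImD x y : Im (x + y) = Im x + Im y.
Proof. by case: x y => a b [c d]. Qed.

Lemma ReB x y : Re (x - y) = Re x - Re y.
Proof. by case: x y => a b [c d]. Qed.

Lemma ImB x y : Im (x - y) = Im x - Im y.
Proof. by case: x y => a b [c d]. Qed.

(** Complex differentiability at [z], with errors measured by the real-valued
    modulus. *)
Definition cderiv (f : R[i] -> R[i]) z :=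
  exists d : R[i], forall e : R, 0 < e ->
  exists2 dl : R, 0 < dl & forall w, normc (w - z) < dl ->
    normc (f w - f z - d * (w - z)) <= e * normc (w - z).

Lemma cdifferentiable_cderiv (f : R[i] -> R[i]) z :
  @cdifferentiable R[i] f z -> cderiv f z.
Proof.
move=> /cdifferentiable_approx H.
exists ('D_1 (f : R[i]^o -> R[i]^o) z) => e e0.
have ec0 : 0 < (e%:C)%C by rewrite ltcR.
have [[dl dli] dl0 K] := H _ ec0.
move: dl0; rewrite ltcE /= => /andP[/eqP dli0 dl0].
exists dl => // w wz; have := K w.
rewrite -!normc_normr dli0 ltcR => /(_ wz).
by rewrite -rmorphM /= lecR.
Qed.

(** Continuity at [z], in the same form. *)
Definition ccont (f : R[i] -> R[i]) z := forall e : R, 0 < e ->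
  exists2 dl : R, 0 < dl &
    forall w, normc (w - z) < dl -> normc (f w - f z) < e.

Lemma cderiv_cont f z : cderiv f z -> ccont f z.
Proof.
move=> [d H] e e0; have [dl dl0 K] := H 1 ltr01.
have D0 : 0 < 1 + normc d by rewrite ltr_pwDl ?normc_ge0.
exists (Num.min dl (e / (1 + normc d))); first by rewrite lt_min dl0 divr_gt0.
move=> w; rewrite lt_min => /andP[w1 w2].
have -> : f w - f z = (f w - f z - d * (w - z)) + d * (w - z) by rewrite subrK.
apply: le_lt_trans (ler_normcD _ _) _; rewrite normcM.
apply: (@le_lt_trans _ _ (1 * normc (w - z) + normc d * normc (w - z))).
  by rewrite lerD2r K.
by rewrite -mulrDl mulrC -ltr_pdivlMr.
Qed.

End Modulus.

(** * Integration over segments, and bisection of rectangles *)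

Section SegmentIntegral.
Variable R : realType.
Implicit Types (f g : R -> R) (a b m : R).
Local Notation mu := (@lebesgue_measure R).

(** The Lebesgue integral over the segment from [a] to [b], for [a <= b]. *)
Definition segint f a b : R := \int[mu]_(x in `[a, b]) f x.

(** Two-sided continuity at every point of the segment, endpoints included:
    the functions integrated below extend past the endpoints. *)
Definition seg_continuous f a b :=
  forall x, a <= x <= b -> {for x, continuous f}.

Lemma seg_integrable f a b : seg_continuous f a b ->
  mu.-integrable `[a, b] (EFin \o f).
Proof.
move=> cf; apply: continuous_compact_integrable; first exact: segment_compact.
apply: continuous_in_subspaceT => x; rewrite inE /= in_itv /= => xab.
exact: cf.
Qed.

Lemma segint_split f a m b : seg_continuous f a b -> a <= m <= b ->
  segint f a b = segint f a m + segint f m b.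
Proof.
move=> cf /andP[am mb]; have fi := seg_integrable cf.
have := @Rintegral_itvB R f (BLeft a) (BRight b) m fi.
rewrite !bnd_simp am mb => /(_ isT isT) /eqP; rewrite subr_eq addrC => /eqP.
rewrite Rintegral_itv_obnd_cbnd //.
by apply: integrableS fi => //; apply: subset_itv; rewrite bnd_simp.
Qed.

Lemma segintB f g a b : seg_continuous f a b -> seg_continuous g a b ->
  segint (fun x => f x - g x) a b = segint f a b - segint g a b.
Proof.
by move=> cf cg; rewrite /segint RintegralB //; exact: seg_integrable.
Qed.

Lemma segint_cst (k : R) a b : a <= b -> segint (fun=> k) a b = k * (b - a).
Proof.
move=> ab; rewrite /segint Rintegral_cst //= lebesgue_measure_itv /= lte_fin.
by rewrite lt_neqAle ab andbT; case: eqVneq => [->|_] /=; rewrite ?subrr.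
Qed.

Lemma ler_segint f g a b : seg_continuous f a b -> seg_continuous g a b ->
  (forall x, a <= x <= b -> f x <= g x) -> segint f a b <= segint g a b.
Proof.
move=> cf cg fg; apply: le_Rintegral; do ?exact: seg_integrable; first by [].
by move=> x /=; rewrite in_itv /=; exact: fg.
Qed.

Lemma seg_continuous_cst (k : R) a b : seg_continuous (fun=> k) a b.
Proof. by move=> x _; exact: cst_continuous. Qed.

Lemma segint_approx f (k e : R) a b : seg_continuous f a b -> a <= b ->
  (forall x, a <= x <= b -> `|f x - k| <= e) ->
  `|segint f a b - k * (b - a)| <= e * (b - a).
Proof.
move=> cf ab H; rewrite ler_distl -mulrBl -mulrDl -!segint_cst //.
apply/andP; split; apply: ler_segint; do ?by [exact: seg_continuous_cst|].
  by move=> x /H; rewrite ler_distl => /andP[].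
by move=> x /H; rewrite ler_distl => /andP[].
Qed.

Lemma eq_segint f g a b : (forall x, a <= x <= b -> f x = g x) ->
  segint f a b = segint g a b.
Proof.
move=> fg; apply: eq_Rintegral => x; rewrite inE /= in_itv /=; exact: fg.
Qed.

End SegmentIntegral.

Section Bisection.
Variable R : realType.

(** An interval is given by its pair of endpoints; [q] is the left or the right
    half of [p]. *)
Definition half_itv (p q : R * R) : Prop :=
  q = (p.1, (p.1 + p.2) / 2) \/ q = ((p.1 + p.2) / 2, p.2).

Lemma nested_halves (u : nat -> R * R) :
  (u 0).1 <= (u 0).2 -> (forall k, half_itv (u k) (u k.+1)) ->
  exists x, forall k, (u k).1 <= x <= (u k).2.
Proof.
move=> u0 H.
have le12 k : (u k).1 <= (u k).2.
  by elim: k => // k; case: (H k) => -> /=; lra.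
have step k : (u k).1 <= (u k.+1).1 /\ (u k.+1).2 <= (u k).2.
  by have := le12 k; case: (H k) => -> /=; lra.
have mono k m : (u k).1 <= (u (k + m)%N).1 /\ (u (k + m)%N).2 <= (u k).2.
  elim: m => [|m [IH1 IH2]]; first by rewrite addn0.
  rewrite addnS; have [s1 s2] := step (k + m)%N.
  by split; [exact: le_trans s1|exact: le_trans IH2].
have cross k m : (u k).1 <= (u m).2.
  have [h1 _] := mono k m; have [_ h2] := mono m k.
  by apply: le_trans h1 _; apply: le_trans (le12 _) _; rewrite addnC.
have hs : has_sup (range (fun k => (u k).1)).
  split; first by exists (u 0).1; exists 0%N.
  by exists (u 0).2 => _ [k _ <-].
exists (sup (range (fun k => (u k).1))) => k; apply/andP; split.
  by apply: sup_upper_bound => //; exists k.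
by apply: ge_sup; [case: hs|move=> _ [m _ <-]].
Qed.

Lemma half_itv_size (u : nat -> R * R) : (forall k, half_itv (u k) (u k.+1)) ->
  forall k, (u k).2 - (u k).1 = ((u 0).2 - (u 0).1) / 2 ^+ k.
Proof.
move=> H; elim=> [|k IH]; first by rewrite expr0 divr1.
have -> : (u k.+1).2 - (u k.+1).1 = ((u k).2 - (u k).1) / 2.
  by case: (H k) => -> /=; lra.
by rewrite IH exprS invfM mulrCA mulrC.
Qed.

Lemma exp2_small (a e : R) : 0 < e -> exists k, a / 2 ^+ k < e.
Proof.
move=> e0; exists (Num.bound (a / e)).
by rewrite ltr_pdivrMr ?exprn_gt0// mulrC -ltr_pdivrMr//; exact: upper_nthrootP.
Qed.

(** A property that each rectangle having it hands down to one of its four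
    quarters accumulates at a point: arbitrarily small rectangles around that
    point have the property. *)
Lemma rectangle_bisection (P : R * R -> R * R -> Prop) (p q : R * R) :
  (forall p q, p.1 <= p.2 -> q.1 <= q.2 -> P p q ->
    exists p' q', [/\ half_itv p p', half_itv q q' & P p' q']) ->
  p.1 <= p.2 -> q.1 <= q.2 -> P p q ->
  exists x y, forall e, 0 < e -> exists p' q',
   [/\ p.1 <= p'.1 /\ p'.2 <= p.2, q.1 <= q'.1 /\ q'.2 <= q.2,
     p'.1 <= x <= p'.2 /\ q'.1 <= y <= q'.2,
     p'.2 - p'.1 < e /\ q'.2 - q'.1 < e & P p' q'].
Proof.
move=> H p12 q12 Ppq.
pose Q (s : (R * R) * (R * R)) :=
  [/\ s.1.1 <= s.1.2, s.2.1 <= s.2.2 & P s.1 s.2].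
(* [Q] is the invariant of the sequence of rectangles, [T] its transitions. *)
pose T (s s' : (R * R) * (R * R)) :=
  half_itv s.1 s'.1 /\ half_itv s.2 s'.2.
have step s : {s' | Q s -> T s s' /\ Q s'}.
  apply: cid; have [[s1 s2 Ps]|nQ] := pselect (Q s); last by exists s.
  have [p' [q' [hp hq P']]] := H _ _ s1 s2 Ps.
  exists (p', q') => _; split => //; split => //.
    by case: hp => -> /=; lra.
  by case: hq => -> /=; lra.
have [u [u0 uS]] := dependent_choice step (p, q).
have Qu k : Q (u k) by elim: k => [|k IH]; [rewrite u0|have [] := uS _ IH].
have h1 k : half_itv (u k).1 (u k.+1).1 by have [[]] := uS _ (Qu k).
have h2 k : half_itv (u k).2 (u k.+1).2 by have [[]] := uS _ (Qu k).
have := @nested_halves (fun k => (u k).1); rewrite u0 => /(_ p12 h1)[x hx].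
have := @nested_halves (fun k => (u k).2); rewrite u0 => /(_ q12 h2)[y hy].
exists x, y => e e0.
have [k1 hk1] := exp2_small (p.2 - p.1 + (q.2 - q.1)) e0.
have le2 : 0 < (2 ^+ k1 : R)^-1 by rewrite invr_gt0 exprn_gt0.
have mono (v : nat -> R * R) m : (forall k, half_itv (v k) (v k.+1)) ->
    (v 0).1 <= (v 0).2 ->
    [/\ (v 0).1 <= (v m).1, (v m).2 <= (v 0).2 & (v m).1 <= (v m).2].
  move=> hv v0; elim: m => [//|m [? ? ?]].
  by case: (hv m) => -> /=; split; lra.
exists (u k1).1, (u k1).2; split.
- by have := mono (fun k => (u k).1) k1 h1; rewrite u0 => /(_ p12)[].
- by have := mono (fun k => (u k).2) k1 h2; rewrite u0 => /(_ q12)[].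
- by split.
- rewrite (@half_itv_size (fun k => (u k).1)) // u0 /=.
  rewrite (@half_itv_size (fun k => (u k).2)) // u0 /=.
  move: hk1; rewrite mulrDl => hk1.
  have : 0 <= (p.2 - p.1) / 2 ^+ k1 by rewrite mulr_ge0 ?subr_ge0// ltW.
  have : 0 <= (q.2 - q.1) / 2 ^+ k1 by rewrite mulr_ge0 ?subr_ge0// ltW.
  by lra.
- by have [] := Qu k1.
Qed.

End Bisection.

(** * Goursat's theorem on rectangles *)

Section Goursat.
Variable R : realType.
Variable f : R[i] -> R[i].

(** The real part of [f] along a horizontal line, and the imaginary part of [f]
    along a vertical one. *)
Definition hline (c : R) : R -> R := fun x => Re (f (x +i* c)%C).
Definition vline (a : R) : R -> R := fun y => Im (f (a +i* y)%C).

(** The real part of the integral of [f] along the boundary of the rectangle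
    with sides [p] (horizontal) and [q] (vertical). The imaginary part is not
    needed: it is the real part for [- 'i * f]. *)
Definition rect_circ (p q : R * R) : R :=
  segint (fun x => hline q.1 x - hline q.2 x) p.1 p.2 -
  segint (fun y => vline p.2 y - vline p.1 y) q.1 q.2.

(** [f] is complex differentiable at each point of the closed rectangle. *)
Definition cderiv_rect (p q : R * R) := forall x y,
  p.1 <= x <= p.2 -> q.1 <= y <= q.2 -> cderiv f (x +i* y)%C.

Lemma ccont_real (g : R -> R[i]) (h : R[i] -> R) x :
  (forall z w, `|h z - h w| <= normc (z - w)) ->
  (forall t, normc (g t - g x) <= `|t - x|) ->
  ccont f (g x) -> {for x, continuous (fun t => h (f (g t)))}.
Proof.
move=> hh hg cf; apply/cvgrPdist_lt => e e0.
have [dl dl0 H] := cf e e0; apply/nbhs_ballP; exists dl => // t.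
rewrite /ball /= distrC => tx; rewrite distrC.
by apply: le_lt_trans (hh _ _) _; apply: H; apply: le_lt_trans tx.
Qed.

Lemma hline_continuous c x : ccont f (x +i* c)%C ->
  {for x, continuous (hline c)}.
Proof.
apply: (@ccont_real (fun t => (t +i* c)%C) (@complex.Re R)).
  by move=> z w; rewrite -ReB ler_Re_normc.
by move=> t; rewrite -[_ - _]/(_ +i* _)%C subrr normc_real.
Qed.

Lemma vline_continuous a y : ccont f (a +i* y)%C ->
  {for y, continuous (vline a)}.
Proof.
apply: (@ccont_real (fun t => (a +i* t)%C) (@complex.Im R)).
  by move=> z w; rewrite -ImB ler_Im_normc.
move=> t; apply: le_trans (ler_normc_ReIm _) _.
by rewrite -[_ - _]/(_ +i* _)%C /= subrr normr0 add0r.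
Qed.

Lemma hline_seg p q c : cderiv_rect p q -> q.1 <= c <= q.2 ->
  seg_continuous (hline c) p.1 p.2.
Proof. by move=> H hc x hx; apply/hline_continuous/cderiv_cont/H. Qed.

Lemma vline_seg p q a : cderiv_rect p q -> p.1 <= a <= p.2 ->
  seg_continuous (vline a) q.1 q.2.
Proof. by move=> H ha x hx; apply/vline_continuous/cderiv_cont/H. Qed.

Lemma seg_continuousB (g h : R -> R) (a b : R) :
  seg_continuous g a b -> seg_continuous h a b ->
  seg_continuous (fun x => g x - h x) a b.
Proof. by move=> cg ch x hx; apply: cvgB; [exact: cg|exact: ch]. Qed.

Lemma rect_circ_hsplit a m b q : q.1 <= q.2 -> cderiv_rect (a, b) q ->
  a <= m <= b ->
  rect_circ (a, b) q = rect_circ (a, m) q + rect_circ (m, b) q.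
Proof.
move=> q12 df amb; have [am mb] := andP amb; have ab := le_trans am mb.
have hq1 : q.1 <= q.1 <= q.2 by rewrite lexx.
have hq2 : q.1 <= q.2 <= q.2 by rewrite lexx andbT.
rewrite /rect_circ /= (@segint_split _ _ a m b) //; last first.
  by apply: seg_continuousB; [exact: hline_seg df _|exact: hline_seg df _].
have cv x : a <= x <= b -> seg_continuous (vline x) q.1 q.2.
  by move=> hx; exact: vline_seg df _.
have D u v : a <= u <= b -> a <= v <= b ->
    segint (fun y => vline u y - vline v y) q.1 q.2 =
    segint (vline u) q.1 q.2 - segint (vline v) q.1 q.2.
  by move=> hu hv; apply: segintB; exact: cv.
by rewrite !D ?lexx ?am ?mb ?ab //; ring.
Qed.

Lemma rect_circ_vsplit p c m d : p.1 <= p.2 -> cderiv_rect p (c, d) ->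
  c <= m <= d ->
  rect_circ p (c, d) = rect_circ p (c, m) + rect_circ p (m, d).
Proof.
move=> p12 df cmd; have [cm md] := andP cmd; have cd := le_trans cm md.
have hp1 : p.1 <= p.1 <= p.2 by rewrite lexx.
have hp2 : p.1 <= p.2 <= p.2 by rewrite lexx andbT.
rewrite /rect_circ /=.
rewrite (@segint_split _ (fun y => vline p.2 y - _) c m d) //; last first.
  by apply: seg_continuousB; [exact: vline_seg df _|exact: vline_seg df _].
have ch y : c <= y <= d -> seg_continuous (hline y) p.1 p.2.
  by move=> hy; exact: hline_seg df _.
have D u v : c <= u <= d -> c <= v <= d ->
    segint (fun x => hline u x - hline v x) p.1 p.2 =
    segint (hline u) p.1 p.2 - segint (hline v) p.1 p.2.
  by move=> hu hv; apply: segintB; exact: ch.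
by rewrite !D ?lexx ?cm ?md ?cd //; ring.
Qed.

(** Affine functions have zero circulation, so differentiability at a point of
    the rectangle makes the circulation small relative to the squared size. *)
Lemma rect_circ_small (x y e : R) : 0 < e -> cderiv f (x +i* y)%C ->
  exists2 dl, 0 < dl & forall p q,
    p.1 <= x <= p.2 -> q.1 <= y <= q.2 ->
    p.2 - p.1 < dl -> q.2 - q.1 < dl -> cderiv_rect p q ->
    `|rect_circ p q| <= e * (p.2 - p.1 + (q.2 - q.1)) ^+ 2.
Proof.
move=> e0 [D HD]; have e20 : 0 < e / 2 by rewrite divr_gt0.
have [dl dl0 H] := HD _ e20; exists (dl / 2); first by rewrite divr_gt0.
move=> [a b] [c d] /= hx hy hp hq df; set S := b - a + (d - c).
have ab : a <= b by lra.
have cd : c <= d by lra.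
set E := fun w : R[i] => f w - f (x +i* y)%C - D * (w - (x +i* y)%C).
have HE u v : a <= u <= b -> c <= v <= d -> normc (E (u +i* v)%C) <= e / 2 * S.
  move=> hu hv.
  have uvS : normc ((u +i* v)%C - (x +i* y)%C) <= S.
    apply: le_trans (ler_normc_ReIm _) _; rewrite ReB ImB /= /S.
    by apply: lerD; rewrite ler_norml; lra.
  apply: le_trans (H _ _) _; first by rewrite /S in uvS; lra.
  by rewrite ler_wpM2l // ltW.
have fE w : f w = E w + f (x +i* y)%C + D * (w - (x +i* y)%C).
  by rewrite /E; ring.
clearbody E.
have hx1 : a <= a <= b by rewrite lexx.
have hx2 : a <= b <= b by rewrite lexx andbT.
have hy1 : c <= c <= d by rewrite lexx.
have hy2 : c <= d <= d by rewrite lexx andbT.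
have K1 : `|segint (fun x => hline c x - hline d x) a b -
      Im D * (d - c) * (b - a)|
    <= e * S * (b - a).
  apply: segint_approx => //.
    by apply: seg_continuousB; exact: hline_seg df _.
  move=> u hu; rewrite /hline fE (fE (u +i* d)%C) !ReD !ReM !ReB !ImB /=.
  rewrite [X in `|X|](_ : _ = Re (E (u +i* c)%C) - Re (E (u +i* d)%C)).
    2: by ring.
  apply: le_trans (ler_normB _ _) _.
  have := le_trans (ler_Re_normc _) (HE _ _ hu hy1).
  have := le_trans (ler_Re_normc _) (HE _ _ hu hy2).
  by lra.
have K2 : `|segint (fun y => vline b y - vline a y) c d -
      Im D * (b - a) * (d - c)|
    <= e * S * (d - c).
  apply: segint_approx => //.
    by apply: seg_continuousB; exact: vline_seg df _.
  move=> v hv; rewrite /vline fE (fE (a +i* v)%C) !ImD !ImM !ReB !ImB /=.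
  rewrite [X in `|X|](_ : _ = Im (E (b +i* v)%C) - Im (E (a +i* v)%C)).
    2: by ring.
  apply: le_trans (ler_normB _ _) _.
  have := le_trans (ler_Im_normc _) (HE _ _ hx1 hv).
  have := le_trans (ler_Im_normc _) (HE _ _ hx2 hv).
  by lra.
rewrite /rect_circ /=.
set I1 := segint _ a b in K1 *; set I2 := segint _ c d in K2 *.
rewrite (_ : I1 - I2 = (I1 - Im D * (d - c) * (b - a)) -
  (I2 - Im D * (b - a) * (d - c))); last by ring.
apply: le_trans (ler_normB _ _) _; apply: le_trans (lerD K1 K2) _.
by rewrite -mulrDr -/S expr2 mulrA.
Qed.

Lemma cderiv_rect_sub p q p' q' : p.1 <= p'.1 -> p'.2 <= p.2 ->
  q.1 <= q'.1 -> q'.2 <= q.2 -> cderiv_rect p q -> cderiv_rect p' q'.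
Proof. by move=> ? ? ? ? df x y hx hy; apply: df; lra. Qed.

Lemma rect_circ_bisect (eps : R) p q : p.1 <= p.2 -> q.1 <= q.2 ->
  cderiv_rect p q ->
  eps * (p.2 - p.1 + (q.2 - q.1)) ^+ 2 < `|rect_circ p q| ->
  exists p' q', [/\ half_itv p p', half_itv q q' &
   eps * (p'.2 - p'.1 + (q'.2 - q'.1)) ^+ 2 < `|rect_circ p' q'|].
Proof.
case: p q => [a b] [c d] /= ab cd df big.
pose m := (a + b) / 2; pose k := (c + d) / 2.
have amb : a <= m <= b by rewrite /m; lra.
have ckd : c <= k <= d by rewrite /k; lra.
apply: contrapT => no.
have small p' q' : half_itv (a, b) p' -> half_itv (c, d) q' ->
    `|rect_circ p' q'| <= eps * (b - a + (d - c)) ^+ 2 / 4.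
  move=> hp hq; rewrite leNgt; apply/negP => h.
  apply: no; exists p', q'; split => //.
  apply: le_lt_trans h; rewrite le_eqVlt; apply/orP; left; apply/eqP.
  by case: hp hq => -> [] -> /=; lra.
have h1 : half_itv (a, b) (a, m) by left.
have h2 : half_itv (a, b) (m, b) by right.
have h3 : half_itv (c, d) (c, k) by left.
have h4 : half_itv (c, d) (k, d) by right.
have E : rect_circ (a, b) (c, d) =
   rect_circ (a, m) (c, k) + rect_circ (a, m) (k, d) +
   (rect_circ (m, b) (c, k) + rect_circ (m, b) (k, d)).
  rewrite (@rect_circ_hsplit a m b) // -!rect_circ_vsplit //= ; try lra.
    by apply: cderiv_rect_sub df => /=; lra.
  by apply: cderiv_rect_sub df => /=; lra.
move: big; rewrite ltNge => /negP; apply; rewrite E.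
apply: le_trans (ler_normD _ _) _.
apply: le_trans (lerD (ler_normD _ _) (ler_normD _ _)) _.
have := small _ _ h1 h3; have := small _ _ h1 h4.
have := small _ _ h2 h3; have := small _ _ h2 h4.
by lra.
Qed.

Lemma goursat p q : p.1 <= p.2 -> q.1 <= q.2 -> cderiv_rect p q ->
  rect_circ p q = 0.
Proof.
move=> p12 q12 df; apply/eqP/negPn/negP; rewrite -normr_gt0 => J0.
set S := p.2 - p.1 + (q.2 - q.1).
have S1 : 0 < S ^+ 2 + 1 by rewrite ltr_pwDr ?sqr_ge0.
pose eps := `|rect_circ p q| / (S ^+ 2 + 1).
have eps0 : 0 < eps by rewrite divr_gt0.
pose P (p' q' : R * R) := [/\ p.1 <= p'.1 /\ p'.2 <= p.2,
   q.1 <= q'.1 /\ q'.2 <= q.2 &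
   eps * (p'.2 - p'.1 + (q'.2 - q'.1)) ^+ 2 < `|rect_circ p' q'|].
(* [eps] makes the whole rectangle satisfy [P], and [P] is scale invariant:
   halving the sides divides both the bound and the circulation by four. *)
have [||x [y H]] := @rectangle_bisection R P p q _ p12 q12.
- move=> p' q' p'12 q'12 [[? ?] [? ?] big].
  have [//|//||p'' [q'' [hp hq big']]] := @rect_circ_bisect eps p' q' _ _ _ big.
    exact: cderiv_rect_sub df.
  exists p'', q''; split => //; split => //.
    by case: hp => -> /=; lra.
  by case: hq => -> /=; lra.
- split; do ?by rewrite !lexx.
  rewrite -/S /eps mulrAC ltr_pdivrMr // ltr_pM2l //; lra.
have [p1 [q1 [[? ?] [? ?] [? ?] _ _]]] := H 1 ltr01.
have dxy : cderiv f (x +i* y)%C by apply: df; lra.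
have [dl dl0 K] := rect_circ_small eps0 dxy.
have [p' [q' [[? ?] [? ?] [hx hy] [? ?] [_ _]]]] := H dl dl0.
rewrite ltNge => /negP; apply; apply: K => //.
exact: cderiv_rect_sub df.
Qed.

End Goursat.

(** * The complex exponential and the mean value bound *)

Section ComplexExponential.
Variable R : realType.
Implicit Types v w : R[i].

(** The complex exponential, defined from the real exponential and the circular
    functions. *)
Definition cexp w : R[i] :=
  ((expR (Re w) * cos (Im w)) +i* (expR (Re w) * sin (Im w)))%C.

Lemma cexpD v w : cexp (v + w) = cexp v * cexp w.
Proof.
case: v w => a b [c d]; apply/eqP; rewrite eq_complex /=.
by rewrite expRD cosD sinD; apply/andP; split; apply/eqP; ring.
Qed.

Lemma cexp0 : cexp 0 = 1.
Proof. by rewrite /cexp /= expR0 cos0 sin0 mulr1 mulr0. Qed.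

Lemma normc_cexp w : normc (cexp w) = expR (Re w).
Proof.
apply/eqP; rewrite -(@eqrXn2 _ 2) ?normc_ge0 ?expR_ge0 //.
by rewrite normc_sqr /= !exprMn -mulrDr cos2Dsin2 mulr1.
Qed.

Lemma real_derivable_approx (g : R -> R) (D : R) :
  is_derive (0 : R) (1 : R) g D ->
  forall e : R, 0 < e -> exists2 dl : R, 0 < dl &
    forall t, `|t| < dl -> `|g t - g 0 - D * t| <= e * `|t|.
Proof.
move=> [dg <-] e e0; have [dl dl0 H] := @cdifferentiable_approx R g 0 dg e e0.
by exists dl => // t tdl; have := H t; rewrite !subr0 => /(_ tdl).
Qed.

Lemma cderiv_cexp0 : cderiv cexp 0.
Proof.
(* The errors below add up to at most [9 * e' * normc h]. *)
exists 1 => e e0; pose e' := Num.min 1 e / 9.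
have [e'0 e'1 e'e] : [/\ 0 < e', e' <= 1 & 9 * e' <= e].
  by rewrite /e'; case: (leP 1 e) => ?; split; lra.
have [d1 d10 H1] := real_derivable_approx (is_derive_expR (0 : R)) e'0.
have [d2 d20 H2] := real_derivable_approx (is_derive_cos (0 : R)) e'0.
have [d3 d30 H3] := real_derivable_approx (is_derive_sin (0 : R)) e'0.
move: H1 H2 H3; rewrite expR0 sin0 cos0 => H1 H2 H3.
exists (Num.min e' (Num.min d1 (Num.min d2 d3))).
  by rewrite !lt_min e'0 d10 d20.
move=> [s t]; rewrite !subr0 !lt_min mul1r cexp0.
set h := (s +i* t)%C => /and4P[he h1 h2 h3].
have hs : `|s| <= normc h := ler_Re_normc h.
have ht : `|t| <= normc h := ler_Im_normc h.
have := H1 s (le_lt_trans hs h1); have := H2 t (le_lt_trans ht h2).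
have := H3 t (le_lt_trans ht h3).
rewrite mul1r subr0 mul1r oppr0 mul0r subr0 => K3 K2 K1.
apply: le_trans (ler_normc_ReIm _) _; rewrite !ReB !ImB /= subr0.
set S := expR s in K1 *.
have S0 : 0 < S := expR_gt0 s.
have s1 : `|s| <= 1 by lra.
have e's : e' * `|s| <= 1 * 1 by apply: ler_pM => //; exact: ltW.
have S3 : `|S| <= 3.
  rewrite gtr0_norm //; move: K1; rewrite ler_norml => /andP[_ ?].
  by have := ler_norm s; lra.
have SB : `|S - 1| <= 2 * e'.
  rewrite (_ : S - 1 = (S - 1 - s) + s); last by ring.
  apply: le_trans (ler_normD _ _) _.
  have : e' * `|s| <= e' * 1 by rewrite ler_wpM2l // ltW.
  by lra.
have E1 : `|S * cos t - 1 - s| <= e' * `|s| + 3 * (e' * `|t|).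
  rewrite (_ : _ - s = (S - 1 - s) + S * (cos t - 1)); last by ring.
  apply: le_trans (ler_normD _ _) _; apply: lerD => //.
  by rewrite normrM; apply: ler_pM.
have E2 : `|S * sin t - t| <= 3 * (e' * `|t|) + 2 * e' * `|t|.
  rewrite (_ : _ - t = S * (sin t - t) + (S - 1) * t); last by ring.
  apply: le_trans (ler_normD _ _) _; rewrite !normrM.
  by apply: lerD; apply: ler_pM.
apply: le_trans (lerD E1 E2) _; rewrite -[Num.sqrt _]/(normc h).
have : e' * `|s| <= e' * normc h by rewrite ler_wpM2l // ltW.
have : e' * `|t| <= e' * normc h by rewrite ler_wpM2l // ltW.
have : 9 * e' * normc h <= e * normc h by rewrite ler_wpM2r ?normc_ge0.
by lra.
Qed.

Lemma cderiv_comp (f g : R[i] -> R[i]) w :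
  cderiv f (g w) -> cderiv g w -> cderiv (fun v => f (g v)) w.
Proof.
move=> [D HD] dg; have cg := cderiv_cont dg; have [E HE] := dg.
exists (D * E) => e e0.
have nE : 0 < 1 + normc E by rewrite ltr_pwDl ?normc_ge0.
have nD : 0 < 1 + normc D by rewrite ltr_pwDl ?normc_ge0.
have e10 : 0 < e / 2 / (1 + normc E) by rewrite !divr_gt0.
have e20 : 0 < e / 2 / (1 + normc D) by rewrite !divr_gt0.
have [d1 d10 H1] := HD _ e10; have [d2 d20 H2] := HE _ e20.
have [d3 d30 H3] := HE _ ltr01; have [d4 d40 H4] := cg _ d10.
exists (Num.min d2 (Num.min d3 d4)); first by rewrite !lt_min d20 d30.
move=> v; rewrite !lt_min => /and3P[h2 h3 h4].
rewrite [X in normc X <= _](_ : _ = (f (g v) - f (g w) - D * (g v - g w)) +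
  D * (g v - g w - E * (v - w))); last by ring.
apply: le_trans (ler_normcD _ _) _; rewrite normcM.
have K1 := H1 _ (H4 _ h4); have K2 := H2 _ h2; have K3 := H3 _ h3.
set dv := normc (v - w) in K2 K3 *.
have K4 : normc (g v - g w) <= (1 + normc E) * dv.
  rewrite -[g v - g w](subrK (E * (v - w))).
  by apply: le_trans (ler_normcD _ _) _; rewrite normcM mulrDl lerD.
have K5 : normc D * normc (g v - g w - E * (v - w)) <= e / 2 * dv.
  apply: le_trans (ler_wpM2l (normc_ge0 _) K2) _.
  rewrite mulrA ler_wpM2r ?normc_ge0 //.
  rewrite mulrCA ler_piMr ?ler_pdivrMr ?mul1r ?lerDr //.
  by rewrite divr_ge0 // ltW.
have K6 : e / 2 / (1 + normc E) * normc (g v - g w) <= e / 2 * dv.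
  apply: le_trans (ler_wpM2l (ltW e10) K4) _.
  by rewrite mulrA divfK ?gt_eqF.
by lra.
Qed.

Lemma cderiv_affine (a b : R[i]) w : cderiv (fun v => a * v + b) w.
Proof.
exists a => e e0; exists 1 => // v _.
rewrite [X in normc X <= _](_ : _ = 0) ?normc0 ?mulr_ge0 ?normc_ge0 //.
  exact: ltW.
by ring.
Qed.

Lemma cderiv_cexp w : cderiv cexp w.
Proof.
have -> : cexp = (fun v => cexp w * cexp (v + - w) + 0).
  by apply/funext => v; rewrite addr0 -cexpD addrC subrK.
apply: (@cderiv_comp (fun v => cexp w * v + 0) (fun v => cexp (v + - w))).
  exact: cderiv_affine.
apply: (@cderiv_comp cexp (fun v => v + - w)).
  by rewrite subrr; exact: cderiv_cexp0.
have := @cderiv_affine 1 (- w) w.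
by under eq_fun do rewrite mul1r.
Qed.

(** The weak mean value property. The function [f (z0 + cexp w)] is [2 pi 'i]
    periodic, so on a rectangle of height [2 pi] the horizontal sides cancel in
    Goursat's theorem: the integral of [Re f] over the circle of radius
    [expR x] around [z0] does not depend on [x]. Small circles give
    [Re (f z0)]. *)
Lemma mean_value_bound (f : R[i] -> R[i]) z0 (r M : R) : 0 < r ->
  (forall z, normc (z - z0) <= r -> cderiv f z) ->
  (forall z, normc (z - z0) = r -> Re (f z) <= M) ->
  Re (f z0) <= M.
Proof.
move=> r0 df fM; apply/ler_addgt0Pr => e e0.
have z0r : normc (z0 - z0) <= r by rewrite subrr normc0 ltW.
have [dl dl0 H] := cderiv_cont (df _ z0r) e0.
(* The factor ['i] makes [Re f] the imaginary part on the vertical sides. *)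
pose g w := 'i%C * f (1 * cexp w + z0) + 0.
pose m := Num.min dl r / 2.
have [m0 mdl mr] : [/\ 0 < m, m < dl & m <= r].
  by rewrite /m; case: (leP dl r) => ?; split; lra.
have [T T0 [cosT sinT]] : exists2 T : R, 0 < T & cos T = 1 /\ sin T = 0.
  exists (pi *+ 2); last by rewrite cos2pi sin2pi.
  by rewrite mulrn_wgt0 // pi_gt0.
have [a aE] : exists a, expR a = m by exists (ln m); rewrite lnK.
have [b bE] : exists b, expR b = r by exists (ln r); rewrite lnK.
pose p := (a, b); pose q := (0 : R, T).
have p12 : p.1 <= p.2 by rewrite -ler_expR aE bE.
have q12 : q.1 <= q.2 := ltW T0.
have gIm w : Im (g w) = Re (f (cexp w + z0)).
  by rewrite /g addr0 mul1r ImM /= mul0r mul1r add0r.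
have dg : cderiv_rect g p q.
  move=> x y hx hy; set w := (x +i* y)%C.
  apply: (@cderiv_comp (fun v => 'i%C * v + 0) (fun w => f (1 * cexp w + z0))).
    exact: cderiv_affine.
  apply: (@cderiv_comp f (fun w => 1 * cexp w + z0)); last first.
    apply: (@cderiv_comp (fun v => 1 * v + z0)); last exact: cderiv_cexp.
    exact: cderiv_affine.
  apply: df; rewrite addrK mul1r normc_cexp -bE ler_expR.
  by case/andP: hx.
have := goursat p12 q12 dg; rewrite /rect_circ.
have -> : segint (fun x => hline g q.1 x - hline g q.2 x) p.1 p.2 = 0.
  rewrite -[RHS](mul0r (p.2 - p.1)) -(segint_cst 0 p12).
  apply: eq_segint => x _.
  by rewrite /hline /g /cexp /= cosT sinT cos0 sin0 subrr.
have hp1 : p.1 <= p.1 <= p.2 by rewrite lexx p12.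
have hp2 : p.1 <= p.2 <= p.2 by rewrite lexx p12.
rewrite sub0r segintB; [|exact: vline_seg dg hp2|exact: vline_seg dg hp1].
move/eqP; rewrite oppr_eq0 subr_eq0 => /eqP E.
have cv x : p.1 <= x <= p.2 -> seg_continuous (vline g x) 0 T.
  exact: vline_seg dg.
have U : segint (vline g b) 0 T <= M * (T - 0).
  rewrite -(segint_cst M (ltW T0)); apply: ler_segint; first exact: cv.
    exact: seg_continuous_cst.
  move=> y _; rewrite /vline gIm; apply: fM.
  by rewrite addrK normc_cexp /= bE.
have L : (Re (f z0) - e) * (T - 0) <= segint (vline g a) 0 T.
  rewrite -(segint_cst _ (ltW T0)); apply: ler_segint; last first.
  - move=> y _; rewrite /vline gIm; set w := cexp _ + z0.
    have /H : normc (w - z0) < dl by rewrite addrK normc_cexp /= aE.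
    move=> /ltW /(le_trans (ler_Re_normc _)); rewrite ReB ler_distl.
    by case/andP.
  - exact: cv.
  - exact: seg_continuous_cst.
move: E => /= E; rewrite E in U; have := le_trans L U.
by rewrite subr0 (ler_pM2r T0) lerBlDr.
Qed.

End ComplexExponential.

(** * The maximum modulus principle *)

Section MaximumModulus.
Variable R : realType.

(** The closed disc of radius [rho] around the origin, as a set of pairs of real
    coordinates. *)
Definition closed_disc_pairs (rho : R) : set (R * R) :=
  [set p | p.1 ^+ 2 + p.2 ^+ 2 <= rho ^+ 2].

Lemma compact_closed_disc (rho : R) : 0 < rho -> compact (closed_disc_pairs rho).
Proof.
move=> rho0.
apply: (@subclosed_compact _ _
  (`[- rho, rho]%classic `*` `[- rho, rho]%classic)).
- apply: (@closed_comp _ _ (fun p : R * R => p.1 ^+ 2 + p.2 ^+ 2)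
     [set x | x <= rho ^+ 2]); last exact: closed_le.
  move=> p _; apply: cvgD.
    apply: (@cvgM _ _ _ _ (fun p : R * R => p.1) (fun p => p.1));
      exact: cvg_fst.
  apply: (@cvgM _ _ _ _ (fun p : R * R => p.2) (fun p => p.2));
    exact: cvg_snd.
- by apply: compact_setX; exact: segment_compact.
- move=> [x y]; rewrite /closed_disc_pairs /= !in_itv /= => h.
  have x2 := sqr_ge0 x; have y2 := sqr_ge0 y.
  by split; rewrite -ler_norml -(@ler_pXn2r _ 2) ?nnegrE ?(ltW rho0) //
    real_normK ?num_real //; lra.
Qed.

Lemma closed_disc_max (V : R[i] -> R) (rho : R) : 0 < rho ->
  (forall z, normc z <= rho -> forall e : R, 0 < e -> exists2 dl : R, 0 < dl &
    forall w, normc (w - z) < dl -> `|V w - V z| < e) ->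
  exists2 z0, normc z0 <= rho & forall z, normc z <= rho -> V z <= V z0.
Proof.
move=> rho0 cV.
have discE x y : (x, y) \in closed_disc_pairs rho <-> normc (x +i* y)%C <= rho.
  rewrite inE /closed_disc_pairs /= -(@ler_pXn2r _ 2 isT (Num.sqrt _)) //.
  - by rewrite sqr_sqrtr ?addr_ge0 ?sqr_ge0.
  - by rewrite nnegrE sqrtr_ge0.
  - by rewrite nnegrE ltW.
have [[x0 y0] h0 hmax] : exists2 c, c \in closed_disc_pairs rho &
   forall t, t \in closed_disc_pairs rho ->
     V (t.1 +i* t.2)%C <= V (c.1 +i* c.2)%C.
  apply: (@compact_EVT_max _ R (fun t : R * R => V (t.1 +i* t.2)%C)).
  - exists (0, 0); rewrite /closed_disc_pairs /=.
    by rewrite expr0n addr0 sqr_ge0.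
  - exact: compact_closed_disc.
  - apply: continuous_in_subspaceT => -[x y] /discE xy.
    apply/cvgrPdist_lt => e e0; have [dl dl0 H] := cV _ xy e e0.
    have dl2 : 0 < dl / 2 by rewrite divr_gt0.
    exists (ball x (dl / 2), ball y (dl / 2)).
      by split; exact: nbhsx_ballx.
    move=> [s t] [/= xs yt]; rewrite distrC; apply: H.
    apply: le_lt_trans (ler_normc_ReIm _) _; rewrite ReB ImB /=.
    move: xs yt; rewrite /ball /= (distrC x) (distrC y); lra.
exists (x0 +i* y0)%C; first exact/discE.
by move=> [x y] /discE /hmax.
Qed.

Lemma sqr_normc_cont (U : R[i] -> R[i]) z : ccont U z ->
  forall e : R, 0 < e -> exists2 dl : R, 0 < dl &
    forall w, normc (w - z) < dl -> `|normc (U w) ^+ 2 - normc (U z) ^+ 2| < e.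
Proof.
move=> cU e e0; set N := normc (U z).
have N0 : 0 <= N := normc_ge0 _.
have D0 : 0 < 1 + 2 * N by lra.
have m0 : 0 < Num.min 1 (e / (1 + 2 * N)) by rewrite lt_min ltr01 divr_gt0.
have [dl dl0 H] := cU _ m0; exists dl => // w /H.
rewrite lt_min ltr_pdivlMr // => /andP[h1 h2].
set d := normc (U w - U z) in h1 h2.
have d0 : 0 <= d := normc_ge0 _.
have w0 : 0 <= normc (U w) := normc_ge0 _.
have t1 : normc (U w) <= d + N by rewrite -[U w](subrK (U z)) ler_normcD.
have t2 : N <= d + normc (U w).
  by rewrite /d normc_distC /N -{1}[U z](subrK (U w)) ler_normcD.
have t3 : `|normc (U w) - N| <= d by rewrite ler_norml; lra.
rewrite subr_sqr normrM; apply: le_lt_trans h2.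
by apply: ler_pM => //; rewrite ger0_norm; lra.
Qed.

(** The maximum modulus principle on a disc, for a continuous function which
    need only be holomorphic near the points where it does not vanish. If the
    bound failed, [normc (U z) ^+ 2 + eps * normc z ^+ 2] would have, for a
    small [eps], an interior maximum [z0] with [U z0 != 0]; then the holomorphic
    function [(U z0)^* * U w + eps * z0^* * (w - z0)] has on a small circle
    around [z0] a real part bounded by something smaller than its value
    [normc (U z0) ^+ 2] at the centre. *)
Lemma maximum_modulus (U : R[i] -> R[i]) (rho B : R) : 0 < rho -> 0 <= B ->
  (forall z, normc z <= rho -> ccont U z) ->
  (forall z, normc z < rho -> U z != 0 ->
    exists2 r, 0 < r & forall w, normc (w - z) < r -> cderiv U w) ->
  (forall z, normc z = rho -> normc (U z) <= B) ->
  forall z, normc z <= rho -> normc (U z) <= B.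
Proof.
move=> rho0 B0 cU dU bU z1 z1rho; rewrite leNgt; apply/negP => big.
pose eps := (normc (U z1) ^+ 2 - B ^+ 2) / (2 * rho ^+ 2).
have rho20 : 0 < rho ^+ 2 by rewrite exprn_gt0.
have big2 : B ^+ 2 < normc (U z1) ^+ 2 by rewrite ltr_pXn2r ?nnegrE ?normc_ge0.
have eps0 : 0 < eps by rewrite divr_gt0 ?subr_gt0 ?mulr_gt0.
have epsE : eps * rho ^+ 2 = (normc (U z1) ^+ 2 - B ^+ 2) / 2.
  by rewrite /eps; field; rewrite gt_eqF.
pose V z := normc (U z) ^+ 2 + eps * normc z ^+ 2.
have cV z : normc z <= rho -> forall e : R, 0 < e -> exists2 dl : R, 0 < dl &
    forall w, normc (w - z) < dl -> `|V w - V z| < e.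
  move=> zr e e0; have e20 : 0 < e / 2 by rewrite divr_gt0.
  have [d1 d10 H1] := sqr_normc_cont (cU z zr) e20.
  have e30 : 0 < e / 2 / eps by rewrite divr_gt0.
  have cid : ccont id z by move=> c c0; exists c.
  have [d2 d20 H2] := sqr_normc_cont cid e30.
  exists (Num.min d1 d2); first by rewrite lt_min d10.
  move=> w; rewrite lt_min => /andP[/H1 h1 /H2 h2].
  rewrite (_ : V w - V z = (normc (U w) ^+ 2 - normc (U z) ^+ 2) +
    eps * (normc w ^+ 2 - normc z ^+ 2)); last by rewrite /V; ring.
  apply: le_lt_trans (ler_normD _ _) _.
  move: h2; rewrite normrM (gtr0_norm eps0) ltr_pdivlMr // mulrC => h2.
  by lra.
have [z0 z0rho hmax] := closed_disc_max rho0 cV.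
have V0 : B ^+ 2 + eps * rho ^+ 2 < V z0.
  apply: lt_le_trans (hmax _ z1rho); rewrite epsE /V.
  have : 0 <= eps * normc z1 ^+ 2 by rewrite mulr_ge0 ?sqr_ge0 ?ltW.
  by lra.
have z0lt : normc z0 < rho.
  rewrite lt_neqAle z0rho andbT; apply/eqP => h.
  move: V0; rewrite /V h ltrD2r ltNge => /negP; apply.
  by rewrite ler_pXn2r ?nnegrE ?normc_ge0 // bU.
have U0 : U z0 != 0.
  apply/eqP => h; move: V0.
  rewrite /V h normc0 expr0n add0r ltNge => /negP; apply.
  have : eps * normc z0 ^+ 2 <= eps * rho ^+ 2.
    rewrite ler_pM2l // ler_pXn2r ?nnegrE ?normc_ge0 //; exact: ltW.
  by have := sqr_ge0 B; lra.
have [r r0 dr] := dU _ z0lt U0.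
pose s := Num.min r (rho - normc z0) / 2.
have [s0 sr srho] : [/\ 0 < s, s < r & s <= rho - normc z0].
  by rewrite /s; case: (leP r (rho - normc z0)) => ?; split; lra.
pose f w := (U z0)^*%C * U w +
  (eps%:C%C * (z0^*)%C * w + - (eps%:C%C * (z0^*)%C * z0)).
have df z : normc (z - z0) <= s -> cderiv f z.
  move=> hz.
  have [D1 H1] := dr _ (le_lt_trans hz sr).
  exists ((U z0)^*%C * D1 + eps%:C%C * (z0^*)%C) => e e0.
  have n0 : 0 < 1 + normc (U z0) by rewrite ltr_pwDl ?normc_ge0.
  have [dl dl0 H] := H1 (e / (1 + normc (U z0))) (divr_gt0 e0 n0).
  exists dl => // w /H h; rewrite [X in normc X <= _](_ : _ =
    (U z0)^*%C * (U w - U z - D1 * (w - z))); last by rewrite /f; ring.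
  rewrite normcM normcJ; apply: le_trans (ler_wpM2l (normc_ge0 _) h) _.
  rewrite mulrA ler_wpM2r ?normc_ge0 // mulrCA ler_piMr ?(ltW e0) //.
  by rewrite ler_pdivrMr // mul1r lerDr.
have := @mean_value_bound R f z0 s (normc (U z0) ^+ 2 - eps * s ^+ 2 / 2) s0 df.
have -> : Re (f z0) = normc (U z0) ^+ 2.
  by rewrite /f subrr addr0 normc_sqr; case: (U z0) => a b /=; ring.
move=> K; have {}K : normc (U z0) ^+ 2 <= normc (U z0) ^+ 2 - eps * s ^+ 2 / 2.
  apply: K => w hw.
  have wrho : normc w <= rho.
    rewrite -[w](subrK z0); apply: le_trans (ler_normcD _ _) _; rewrite hw; lra.
  have := hmax _ wrho; rewrite /V.
  have := congr1 (fun x => eps * x ^+ 2) hw; rewrite /= !normc_sqr /f.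
  case: (U z0) => a b; case: (U w) => c d; case: (w) => x y; case: (z0) => u v.
  rewrite /= => E1 E2.
  have := sqr_ge0 (a - c); have := sqr_ge0 (b - d).
  by lra.
have : 0 < eps * s ^+ 2 by rewrite mulr_gt0 ?exprn_gt0.
by lra.
Qed.

End MaximumModulus.

(** * Simultaneous triangularization and power sums *)

Section Triangular.
Variables (K : comNzRingType) (n : nat).
Implicit Types A B : 'M[K]_n.+1.

Lemma mul_trig_diag A B : is_trig_mx A -> is_trig_mx B ->
  forall i, (A * B) i i = A i i * B i i.
Proof.
move=> /is_trig_mxP tA /is_trig_mxP tB i; rewrite mxE.
rewrite (bigD1 i) //= big1 ?addr0 //.
move=> j ji; have [lt_ij|lt_ji|/val_inj eq_ij] := ltngtP i j.
- by rewrite tA ?mul0r.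
- by rewrite tB ?mulr0.
- by rewrite eq_ij eqxx in ji.
Qed.

Lemma mul_is_trig A B : is_trig_mx A -> is_trig_mx B -> is_trig_mx (A * B).
Proof.
move=> /is_trig_mxP tA /is_trig_mxP tB; apply/is_trig_mxP => i j ij.
rewrite mxE big1 // => k _.
have [ik|ki] := ltnP i k; first by rewrite tA ?mul0r.
by rewrite tB ?mulr0 // (leq_ltn_trans ki).
Qed.

Lemma add_is_trig A B : is_trig_mx A -> is_trig_mx B -> is_trig_mx (A + B).
Proof.
move=> /is_trig_mxP tA /is_trig_mxP tB; apply/is_trig_mxP => i j ij.
by rewrite mxE tA // tB // addr0.
Qed.

Lemma horner_trig A (p : {poly K}) : is_trig_mx A ->
  is_trig_mx (horner_mx A p) /\ forall i, (horner_mx A p) i i = p.[A i i].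
Proof.
move=> tA; elim/poly_ind: p => [|p c [IHt IHd]].
  by rewrite rmorph0 mx0_is_trig; split => // i; rewrite mxE horner0.
rewrite rmorphD rmorphM /= horner_mx_X horner_mx_C; split.
  by apply: add_is_trig (mul_is_trig IHt tA) (scalar_mx_is_trig _ _).
by move=> i; rewrite mxE mul_trig_diag // IHd !mxE eqxx hornerMXaddC.
Qed.

Lemma exp_trig A k : is_trig_mx A ->
  is_trig_mx (A ^+ k) /\ forall i, (A ^+ k) i i = A i i ^+ k.
Proof.
move=> tA; elim: k => [|k [IHt IHd]].
  by rewrite expr0 scalar_mx_is_trig; split => // i; rewrite expr0 mxE eqxx.
by rewrite exprS; split=> [|i]; rewrite ?mul_is_trig ?mul_trig_diag ?IHd ?exprS.
Qed.

End Triangular.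

Section CommutingSpectra.
Variables (C : numClosedFieldType) (n : nat).
Implicit Types W V : 'M[C]_n.+1.

(** The diagonal entries [t] and [v] of simultaneous triangularizations of two
    commuting matrices compute the spectrum of [W] and the determinants and
    traces of polynomial expressions. *)
Lemma commuting_spectra W V : W * V = V * W ->
  exists t v : 'I_n.+1 -> C,
  [/\ forall a, eigenvalue W a <-> exists i, a = t i,
      forall p, \det (horner_mx W p) = \prod_i p.[t i],
      forall p, horner_mx W p * V = 1 -> forall i, p.[t i] * v i = 1 &
      forall p k, \tr ((horner_mx W p * V) ^+ k) = \sum_i (p.[t i] * v i) ^+ k].
Proof.
move=> /cotrigonalization2[P /unitarymx_unit Pu /andP[/= tT tS]].
set T := conjmx P W in tT; set S := conjmx P V in tS.
have conjE A : conjmx P A = P * A * P^-1 by rewrite conjumx.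
have conjM A B : conjmx P (A * B) = conjmx P A * conjmx P B.
  by rewrite !conjE !mulrA mulrVK.
have conjX A k : conjmx P (A ^+ k) = conjmx P A ^+ k.
  elim: k => [|k IH]; last by rewrite !exprS conjM IH.
  by rewrite !expr0 conjE mulr1 divrr.
have conjH p : conjmx P (horner_mx W p) = horner_mx T p.
  by rewrite /T !conjumx // horner_mx_uconj.
have trE A : \tr (conjmx P A) = \tr A.
  by rewrite conjE mxtrace_mulC [P^-1 *m _]mulrA mulVr ?mul1r.
exists (fun i => T i i), (fun i => S i i); split.
- move=> a; rewrite eigenvalue_root_min -(mxminpoly_uconj W Pu) -/T.
  rewrite -eigenvalue_root_min eigenvalue_root_char char_poly_trig //.
  rewrite rootE horner_prod.
  split=> [/prodf_eq0[i _]|[i ->]].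
    by rewrite hornerXsubC subr_eq0 => /eqP; exists i.
  by apply/prodf_eq0; exists i => //; rewrite hornerXsubC subrr.
- move=> p; have [t1 d1] := horner_trig p tT.
  have <- : \det (conjmx P (horner_mx W p)) = \det (horner_mx W p).
    by rewrite conjE det_mulmx mulrC -det_mulmx [P^-1 *m _]mulrA mulVr ?mul1r.
  by rewrite conjH det_trig //; apply: eq_bigr => i _.
- move=> p /(congr1 (conjmx P)); rewrite conjM conjH (conjE 1) mulr1 divrr //.
  move=> E i; have [t1 d1] := horner_trig p tT.
  by rewrite -d1 -mul_trig_diag // E mxE eqxx.
- move=> p k; rewrite -trE conjX conjM conjH.
  have [t1 d1] := horner_trig p tT; have t2 := mul_is_trig t1 tS.
  apply: eq_bigr => i _; have [_ ->] := exp_trig k t2.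
  by rewrite mul_trig_diag ?d1.
Qed.

End CommutingSpectra.

Section PowerSums.
Variable R : realType.
Implicit Types (b : R[i]) (s : seq R[i]).

Lemma bernoulli (x : R) k : 0 <= x -> 1 + k%:R * x <= (1 + x) ^+ k.
Proof.
move=> x0; elim: k => [|k IH]; first by rewrite mul0r addr0 expr0.
have x1 : 0 <= 1 + x by rewrite addr_ge0.
rewrite exprS; apply: le_trans (ler_wpM2l x1 IH).
have : 0 <= k%:R * x * x by rewrite !mulr_ge0.
by rewrite -natr1; lra.
Qed.

Lemma bounded_powers_le1 (x M : R) : (forall k, x ^+ k.+1 <= M) -> x <= 1.
Proof.
move=> H; rewrite leNgt; apply/negP => x1.
have y0 : 0 < x - 1 by rewrite subr_gt0.
have := archi_boundP (normr_ge0 (M / (x - 1))); set k := Num.bound _ => hk.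
have B : 1 + k.+1%:R * (x - 1) <= M.
  by apply: le_trans (bernoulli _ (ltW y0)) _; rewrite addrC subrK.
have hM : M < k%:R * (x - 1).
  by rewrite -ltr_pdivrMr //; apply: le_lt_trans hk; exact: ler_norm.
by move: B; rewrite -natr1 mulrDl mul1r; lra.
Qed.

Lemma normc_sum (I : Type) (r : seq I) (F : I -> R[i]) :
  normc (\sum_(i <- r) F i) <= \sum_(i <- r) normc (F i).
Proof.
elim: r => [|i r IH]; first by rewrite !big_nil normc0.
by rewrite !big_cons; apply: le_trans (ler_normcD _ _) _; rewrite lerD2l.
Qed.

(** Power sums of geometric growth [c] force each term to have modulus at most
    [c]. A polynomial [l] vanishing at the other elements of [s] isolates [b]:
    [l.[b] * b ^+ k], times the multiplicity of [b], is a fixed linear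
    combination of the power sums of exponents [k], ..., [k + deg l]. *)
Lemma power_sums_bound s (K c : R) : 0 < c ->
  (forall k, normc (\sum_(b <- s) b ^+ k.+1) <= K * c ^+ k.+1) ->
  forall b, b \in s -> normc b <= c.
Proof.
move=> c0 H b bs.
pose l := \prod_(x <- undup s | x != b) ('X - x%:P).
have lb : l.[b] != 0.
  rewrite /l horner_prod big_seq_cond prodf_seq_neq0.
  apply/allP => x _; apply/implyP => /andP[_ xb].
  by rewrite hornerXsubC subr_eq0 eq_sym.
have l0 x : x \in s -> x != b -> l.[x] = 0.
  move=> xs xb; apply/eqP; rewrite /l horner_prod prodf_seq_eq0.
  by apply/hasP; exists x; rewrite ?mem_undup // xb hornerXsubC subrr eqxx.
have E k : \sum_(x <- s) l.[x] * x ^+ k.+1 = l.[b] * b ^+ k.+1 *+ count_mem b s.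
  rewrite (bigID (pred1 b)) /= [X in _ + X]big1_seq ?addr0; last first.
    by move=> x /andP[xb xs]; rewrite l0 // mul0r.
  rewrite (eq_bigr (fun=> l.[b] * b ^+ k.+1)); last by move=> x /eqP ->.
  by rewrite big_const_seq iter_addr_0.
pose L := \sum_(j < size l) normc l`_j * c ^+ j.
have F k : normc (\sum_(x <- s) l.[x] * x ^+ k.+1) <= L * K * c ^+ k.+1.
  under eq_bigr do rewrite horner_coef mulr_suml.
  rewrite exchange_big /=; apply: le_trans (normc_sum _ _) _.
  rewrite /L !mulr_suml; apply: ler_sum => j _.
  under eq_bigr do rewrite -mulrA -exprD addnS.
  rewrite -mulr_sumr normcM -!mulrA ler_wpM2l ?normc_ge0 //.
  apply: le_trans (H _) _.
  by rewrite -addnS exprD mulrCA.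
rewrite -[leRHS]mul1r -ler_pdivrMr //.
have lb0 : 0 < normc l.[b] by rewrite normc_gt0.
apply: (@bounded_powers_le1 _ (L * K / normc l.[b])) => k.
rewrite ler_pdivlMr // expr_div_n mulrAC ler_pdivrMr ?exprn_gt0 //.
apply: le_trans (F k); rewrite E -normcX mulrC -normcM.
have : (0 < count_mem b s)%N by rewrite -has_count has_pred1.
case: (count_mem b s) => // m _.
rewrite -mulr_natr [leRHS]normcM ler_peMr ?normc_ge0 //.
rewrite -lecR rmorph1 normc_normr normr_nat ler1n //.
Qed.

End PowerSums.

(** * The pseudohyperbolic distance *)

Section PseudohyperbolicDistance.
Variable R : realType.
Implicit Types a z : R[i].

Lemma pseudohyp_ge0 z a : 0 <= pseudohyp z a.
Proof. exact: normc_ge0. Qed.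

Lemma pseudohypC z a : pseudohyp z a = pseudohyp a z.
Proof.
rewrite /pseudohyp !normcM !normcV normc_distC; congr (_ / _).
by rewrite -normcJ rmorphB rmorph1 rmorphM /= conjcK mulrC.
Qed.

Lemma pseudohyp_denom z a : normc z < 1 -> normc a < 1 ->
  1 - normc a <= normc (1 - (a^*)%C * z).
Proof.
move=> z1 a1; have := ler_normcD (1 - (a^*)%C * z) ((a^*)%C * z).
rewrite subrK normc1 normcM normcJ => h.
have : normc a * normc z <= normc a by rewrite ler_piMr ?normc_ge0 ?ltW.
by lra.
Qed.

Lemma pseudohyp_denom_neq0 z a : normc z < 1 -> normc a < 1 ->
  1 - (a^*)%C * z != 0.
Proof.
move=> z1 a1; rewrite -normc_gt0; apply: lt_le_trans (pseudohyp_denom z1 a1).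
by rewrite subr_gt0.
Qed.

Lemma pseudohyp_gt0 z a : normc z < 1 -> normc a < 1 -> z != a ->
  0 < pseudohyp z a.
Proof.
move=> z1 a1 za; rewrite /pseudohyp normcM normcV.
apply: divr_gt0; rewrite normc_gt0; first by rewrite subr_eq0.
exact: pseudohyp_denom_neq0.
Qed.

Lemma pseudohyp_defect z a : normc z < 1 -> normc a < 1 ->
  1 - pseudohyp z a ^+ 2 =
  (1 - normc z ^+ 2) * (1 - normc a ^+ 2) / normc (1 - (a^*)%C * z) ^+ 2.
Proof.
move=> z1 a1; have := pseudohyp_denom_neq0 z1 a1; rewrite -normc_eq0 => d0.
rewrite /pseudohyp normcM normcV; set d := normc (1 - _) in d0 *.
have E : d ^+ 2 - normc (z - a) ^+ 2 = (1 - normc z ^+ 2) * (1 - normc a ^+ 2).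
  by rewrite /d !normc_sqr; case: (z) (a) => x y [u v] /=; ring.
by rewrite -E; field.
Qed.

Lemma pseudohyp_le1 z a : normc z < 1 -> normc a < 1 -> pseudohyp z a <= 1.
Proof.
move=> z1 a1; rewrite -(@ler_pXn2r _ 2) ?nnegrE ?pseudohyp_ge0 //.
rewrite expr1n -subr_ge0.
rewrite pseudohyp_defect // divr_ge0 ?sqr_ge0 // mulr_ge0 // subr_ge0.
  by rewrite expr_le1 ?normc_ge0 // ltW.
by rewrite expr_le1 ?normc_ge0 // ltW.
Qed.

(** The distance to a fixed point tends to 1 uniformly as one approaches the
    unit circle. *)
Lemma pseudohyp_near_circle a (eta r0 : R) :
  normc a < 1 -> 0 < eta < 1 -> r0 < 1 ->
  exists rho : R, [/\ 0 < rho, rho < 1, r0 <= rho &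
    forall z, normc z = rho -> 1 - eta <= pseudohyp z a].
Proof.
move=> a1 /andP[eta0 eta1] r01; pose d := 1 - normc a.
have na0 := normc_ge0 a.
have [d0 d1] : 0 < d /\ d <= 1 by rewrite /d; split; lra.
have d2 : 0 < d ^+ 2 <= 1 by rewrite exprn_gt0 // expr_le1 // ltW.
have [ed0 ed1] : 0 < eta * d ^+ 2 /\ eta * d ^+ 2 <= 1.
  by case/andP: d2 => d20 d21; split; rewrite ?mulr_gt0 // mulr_ile1 // ltW.
pose rho := Num.max r0 (1 - eta * d ^+ 2 / 2).
have [h0 h1 h2 h3] : [/\ 0 < rho, rho < 1, r0 <= rho &
    1 - eta * d ^+ 2 / 2 <= rho].
  by rewrite /rho; case: (leP r0 (1 - eta * d ^+ 2 / 2)) => ?; split; lra.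
exists rho; split => // z zr.
have z1 : normc z < 1 by rewrite zr.
have le1 := pseudohyp_le1 z1 a1; have ge0 := pseudohyp_ge0 z a.
have sq : pseudohyp z a ^+ 2 <= pseudohyp z a by rewrite expr2 ler_piMr.
suff : 1 - pseudohyp z a ^+ 2 <= eta by lra.
rewrite pseudohyp_defect //.
have dd : d ^+ 2 <= normc (1 - (a^*)%C * z) ^+ 2.
  rewrite ler_pXn2r ?nnegrE ?normc_ge0 ?(ltW d0) //.
  exact: pseudohyp_denom.
case/andP: d2 => d20 d21.
rewrite ler_pdivrMr; last exact: lt_le_trans dd.
apply: (@le_trans _ _ (eta * d ^+ 2)); last by rewrite ler_wpM2l // ltW.
have a2 : 0 <= normc a ^+ 2 by rewrite sqr_ge0.
have zz : 0 <= 1 - normc z ^+ 2 by rewrite subr_ge0 expr_le1 ?normc_ge0 // ltW.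
apply: (@le_trans _ _ (1 - normc z ^+ 2)).
  by rewrite ler_piMr //; lra.
rewrite zr; have := sqr_ge0 (1 - rho); lra.
Qed.

End PseudohyperbolicDistance.

(** * The Blaschke product of the minimal polynomial *)

Section Blaschke.
Variables (R : realType) (n : nat) (W : 'M[R[i]]_n.+1).

(** Numerator and denominator of the finite Blaschke product whose zeros are the
    eigenvalues of [W], with their multiplicities in the minimal polynomial. *)
Definition blaschke_num : {poly R[i]} :=
  \prod_(a <- spectrum W) ('X - a%:P) ^+ minpoly_mult W a.

Definition blaschke_den : {poly R[i]} :=
  \prod_(a <- spectrum W) (1 - (a^*)%C *: 'X) ^+ minpoly_mult W a.

Lemma blaschke_num_annihilates : horner_mx W blaschke_num = 0.
Proof.
have [r rE] : exists r : seq R[i], mxminpoly W = \prod_(z <- r) ('X - z%:P).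
  have [r rE] := closed_field_poly_normal (mxminpoly W); exists r.
  by rewrite [LHS]rE (monicP (mxminpoly_monic W)) scale1r.
suff -> : blaschke_num = mxminpoly W by exact: mx_root_minpoly.
have mE a : minpoly_mult W a = count_mem a r.
  by rewrite /minpoly_mult rE mu_prod_XsubC.
rewrite rE -big_undup_iterop_count /= /blaschke_num.
rewrite (perm_big (undup r)) /=; last first.
  apply: uniq_perm; rewrite ?undup_uniq ?fset_uniq // => a.
  by rewrite mem_spectrum mem_undup eigenvalue_root_min rE root_prod_XsubC.
by apply: eq_bigr => a _; rewrite mE.
Qed.

Lemma minpoly_mult_gt0 a : a \in spectrum W -> (0 < minpoly_mult W a)%N.
Proof.
rewrite mem_spectrum eigenvalue_root_min -dvdp_XsubCl XsubC_dvd //.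
by rewrite monic_neq0 // mxminpoly_monic.
Qed.

Hypothesis W_ball : spectral_ball W.

Lemma spectral_ball_eigenvalue (A : 'M[R[i]]_n.+1) a :
  spectral_ball A -> eigenvalue A a -> normc a < 1.
Proof.
rewrite /spectral_ball /= /spectral_radius -mem_spectrum => h ha.
by apply: le_lt_trans h; apply: le_bigmax_seq.
Qed.

Lemma blaschke_den_neq0 z : normc z < 1 -> blaschke_den.[z] != 0.
Proof.
move=> z1; rewrite /blaschke_den horner_prod big_seq prodf_seq_neq0.
apply/allP => a _; apply/implyP.
rewrite mem_spectrum => /(spectral_ball_eigenvalue W_ball) a1.
by rewrite horner_exp expf_neq0 // !hornerE pseudohyp_denom_neq0.
Qed.

Lemma normc_blaschke z : 
  normc (blaschke_num.[z] / blaschke_den.[z]) =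
  \prod_(a <- spectrum W) pseudohyp z a ^+ minpoly_mult W a.
Proof.
rewrite /blaschke_num /blaschke_den !horner_prod -prodf_div.
rewrite (big_morph _ (@normcM R) (normc1 R)).
apply: eq_bigr => a _; rewrite !horner_exp -expr_div_n normcX !hornerE.
by rewrite /pseudohyp.
Qed.

Lemma normc_blaschke_le1 z : normc z < 1 ->
  normc (blaschke_num.[z] / blaschke_den.[z]) <= 1.
Proof.
move=> z1; rewrite normc_blaschke big_seq; apply: prodr_ile1 => a.
rewrite mem_spectrum => /(spectral_ball_eigenvalue W_ball) a1.
rewrite exprn_ge0 ?pseudohyp_ge0 //.
by rewrite exprn_ile1 ?pseudohyp_ge0 // pseudohyp_le1.
Qed.

(** The value at [A] of the Blaschke product of [W]. The inverse of the
    denominator is written with the adjugate, so that the entries visibly are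
    rational functions of those of [A]. *)
Definition blaschke_mx (A : 'M[R[i]]_n.+1) : 'M[R[i]]_n.+1 :=
  (\det (horner_mx A blaschke_den))^-1 *:
  (horner_mx A blaschke_num *m \adj (horner_mx A blaschke_den)).

Lemma blaschke_mx_spectrum A : spectral_ball A ->
  \det (horner_mx A blaschke_den) != 0 /\
  exists t : 'I_n.+1 -> R[i],
  (forall a, eigenvalue A a <-> exists i, a = t i) /\
  forall k, \tr (blaschke_mx A ^+ k) =
    \sum_i (blaschke_num.[t i] / blaschke_den.[t i]) ^+ k.
Proof.
move=> A_ball; pose Q := horner_mx A blaschke_den.
have detQ : \det Q != 0.
  have A1 : A * 1 = 1 * A by rewrite mulr1 mul1r.
  have [t [v [tE dE _ _]]] := commuting_spectra A1.
  rewrite dE; apply/prodf_neq0 => i _; apply: blaschke_den_neq0.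
  by apply: (spectral_ball_eigenvalue A_ball); apply/tE; exists i.
split=> //.
pose V := (\det Q)^-1 *: \adj Q.
have QV : Q * V = 1.
  by rewrite /V -scalerAr [Q * _]mul_mx_adj scale_scalar_mx mulVf.
have VQ : V * Q = 1.
  by rewrite /V -scalerAl [_ * Q]mul_adj_mx scale_scalar_mx mulVf.
have AV : A * V = V * A.
  have AQ : A * Q = Q * A by rewrite /Q; exact: comm_mx_horner.
  by rewrite -[A * V]mul1r -VQ -mulrA [Q * _]mulrA -AQ -mulrA QV mulr1.
have [t [v [tE _ inv trE]]] := commuting_spectra AV.
exists t; split => // k.
have -> : blaschke_mx A = horner_mx A blaschke_num * V.
  by rewrite /blaschke_mx /V -scalerAr.
rewrite trE; apply: eq_bigr => i _; congr ((_ * _) ^+ k).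
have := inv _ QV i => h.
have h0 : blaschke_den.[t i] != 0.
  by apply: contra_eq_neq h => ->; rewrite mul0r eq_sym oner_eq0.
by apply: (mulfI h0); rewrite h mulfV.
Qed.

End Blaschke.

(** * The Schwarz lemma for the Blaschke product *)

Section SchwarzPick.
Variables (R : realType) (n : nat) (F : R[i] -> 'M[R[i]]_n.+1).
Hypothesis F_ball : forall z : R[i], unit_disc z -> spectral_ball (F z).
Hypothesis F_holo : holomorphic_on (@unit_disc R) F.
Variable z1 : R[i].
Hypothesis hz1 : unit_disc z1.

Let z1_lt1 : normc z1 < 1. Proof. exact: hz1. Qed.

(** The Blaschke product of [F z1] along [F]: a holomorphic matrix function that
    vanishes at [z1]. *)
Definition blaschke_path z : 'M[R[i]]_n.+1 := blaschke_mx (F z1) (F z).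

Lemma blaschke_path0 : blaschke_path z1 = 0.
Proof.
by rewrite /blaschke_path /blaschke_mx blaschke_num_annihilates mul0mx scaler0.
Qed.

Lemma blaschke_path_diff z :
  unit_disc z -> @mxdifferentiable R[i] _ _ blaschke_path z.
Proof.
move=> hz i j; have dF := derivable_mxdifferentiable (F_holo hz).
have [det0 _] := blaschke_mx_spectrum (F_ball hz1) (F_ball hz).
rewrite /blaschke_path /blaschke_mx; under eq_fun do rewrite mxE.
apply: cdifferentiableM.
  apply: cdifferentiableV => //.
  exact/cdifferentiable_det/mxdifferentiable_horner.
apply: mxdifferentiableM; first exact: mxdifferentiable_horner.
by apply/mxdifferentiable_adj/mxdifferentiable_horner.
Qed.

Lemma blaschke_path_trace z : unit_disc z ->
  exists t : 'I_n.+1 -> R[i],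
  [/\ forall i, normc (t i) < 1,
    forall a, eigenvalue (F z) a <-> exists i, a = t i &
    forall k, \tr (blaschke_path z ^+ k) =
    \sum_i ((blaschke_num (F z1)).[t i] / (blaschke_den (F z1)).[t i]) ^+ k].
Proof.
move=> hz.
have [_ [t [tE trE]]] := blaschke_mx_spectrum (F_ball hz1) (F_ball hz).
exists t; split => // i; apply: (spectral_ball_eigenvalue (F_ball hz)).
by apply/tE; exists i.
Qed.

Lemma blaschke_path_trace_le z k : unit_disc z ->
  normc (\tr (blaschke_path z ^+ k)) <= n.+1%:R.
Proof.
move=> /blaschke_path_trace[t [t1 _ ->]]; apply: le_trans (normc_sum _ _) _.
rewrite -[leRHS](_ : \sum_(i < n.+1) 1 = _); last first.
  by rewrite sumr_const card_ord.
apply: ler_sum => i _; rewrite normcX exprn_ile1 ?normc_ge0 //.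
by apply: normc_blaschke_le1; [exact: F_ball|exact: t1].
Qed.

Lemma blaschke_path_linear_bound : exists c : R, 0 < c /\
  exists2 dl : R, 0 < dl & forall w, normc (w - z1) < dl ->
    forall i j, normc (blaschke_path w i j) <= c * normc (w - z1).
Proof.
have H (ij : 'I_n.+1 * 'I_n.+1) : exists cd : R * R, [/\ 0 < cd.1, 0 < cd.2 &
    forall w, normc (w - z1) < cd.2 ->
      normc (blaschke_path w ij.1 ij.2) <= cd.1 * normc (w - z1)].
  have [d /(_ 1 ltr01)[dl dl0 K]] :=
    cdifferentiable_cderiv (@blaschke_path_diff z1 hz1 ij.1 ij.2).
  exists (1 + normc d, dl); split => //=; first by rewrite ltr_pwDl ?normc_ge0.
  move=> w /K; rewrite blaschke_path0 [X in _ - X - _]mxE subr0 => h.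
  rewrite -[blaschke_path w _ _](subrK (d * (w - z1))).
  by apply: le_trans (ler_normcD _ _) _; rewrite normcM mulrDl lerD2r.
have [cd {}H] := fin_all_exists H.
exists (1 + \sum_ij (cd ij).1); split.
  by rewrite ltr_pwDl // sumr_ge0 // => ij _; have [/ltW] := H ij.
exists (\big[Num.min/1]_ij (cd ij).2).
  by apply: lt_bigmin => // ij _; have [] := H ij.
move=> w hw i j; have [_ _ K] := H (i, j).
apply: le_trans (K w _) _ => /=.
  by apply: lt_le_trans hw _; exact: (bigmin_le_cond _ (fun ij => (cd ij).2)).
rewrite ler_wpM2r ?normc_ge0 // (bigD1 (i, j)) //= addrCA lerDl addr_ge0 //.
by apply: sumr_ge0 => ij _; have [/ltW] := H ij.
Qed.

Lemma mxpow_bound (A : 'M[R[i]]_n.+1) (b : R) k :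
  (forall i j, normc (A i j) <= b) ->
  forall i j, normc ((A ^+ k.+1) i j) <= n.+1%:R ^+ k * b ^+ k.+1.
Proof.
move=> hA; elim: k => [|k IH] i j; first by rewrite expr0 mul1r !expr1.
have b0 : 0 <= b by apply: le_trans (hA ord0 ord0); exact: normc_ge0.
rewrite exprS mxE; apply: le_trans (normc_sum _ _) _.
apply: (@le_trans _ _ (\sum_(l < n.+1) b * (n.+1%:R ^+ k * b ^+ k.+1))).
  by apply: ler_sum => l _; rewrite normcM ler_pM ?normc_ge0.
rewrite sumr_const card_ord -mulr_natl le_eqVlt; apply/orP; left; apply/eqP.
by rewrite [in RHS]exprS [in RHS](exprS b k.+1); ring.
Qed.

(** The trace of the power [k + 1] of [blaschke_path], divided by the power [k]
    of the disc automorphism vanishing at [z1]. One factor of the zero of order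
    [k + 1] is kept, so that the quotient is continuous at [z1] with value 0
    (also the value given by the convention [x / 0 = 0]). *)
Definition quotient_trace k z : R[i] :=
  \tr (blaschke_path z ^+ k.+1) / ((z - z1) / (1 - (z1^*)%C * z)) ^+ k.

Lemma quotient_trace0 k : quotient_trace k z1 = 0.
Proof. by rewrite /quotient_trace blaschke_path0 expr0n /= mxtrace0 mul0r. Qed.

Lemma quotient_trace_cont0 k : ccont (quotient_trace k) z1.
Proof.
have [c [c0 [dl dl0 H]]] := blaschke_path_linear_bound.
pose N : R := n.+1%:R; pose K := N * (N ^+ k * c ^+ k.+1) * 3 ^+ k.
have N0 : 0 < N by rewrite ltr0n.
have K0 : 0 < K by rewrite !mulr_gt0 ?exprn_gt0.
move=> e e0; exists (Num.min dl (Num.min 1 (e / K))).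
  by rewrite !lt_min dl0 ltr01 divr_gt0.
move=> w; rewrite !lt_min quotient_trace0 subr0 => /and3P[w1 w2 w3].
have [->|nw] := eqVneq w z1; first by rewrite quotient_trace0 normc0.
set d := normc (w - z1) in w1 w2 w3.
have d0 : 0 < d by rewrite normc_gt0 subr_eq0.
apply: (@le_lt_trans _ _ (K * d)); last by rewrite mulrC -ltr_pdivlMr.
have trb : normc (\tr (blaschke_path w ^+ k.+1)) <=
    N * (N ^+ k * (c * d) ^+ k.+1).
  apply: le_trans (normc_sum _ _) _.
  apply: (@le_trans _ _ (\sum_(i < n.+1) N ^+ k * (c * d) ^+ k.+1)).
    by apply: ler_sum => i _; apply: mxpow_bound => ? ?; exact: H.
  by rewrite sumr_const card_ord -[leLHS]mulr_natl.
(* The hypothesis [d < 1] keeps [w] in the disc of radius 2. *)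
have denb : normc (1 - (z1^*)%C * w) <= 3.
  apply: le_trans (ler_normcD _ _) _; rewrite normc1 normcN normcM normcJ.
  have wb : normc w <= 2.
    rewrite -[w](subrK z1); apply: le_trans (ler_normcD _ _) _.
    by rewrite -/d; move: z1_lt1; lra.
  have : normc z1 * normc w <= 1 * 2.
    by rewrite ler_pM ?normc_ge0 //; exact: ltW.
  by lra.
rewrite /quotient_trace normcM normcV normcX normcM normcV -/d.
rewrite expr_div_n invf_div mulrA ler_pdivrMr ?exprn_gt0 //.
apply: (@le_trans _ _ (N * (N ^+ k * (c * d) ^+ k.+1) * 3 ^+ k)).
  by rewrite ler_pM ?exprn_ge0 ?normc_ge0 // lerXn2r ?nnegrE ?normc_ge0.
by rewrite /K exprMn (exprS d k) le_eqVlt; apply/orP; left; apply/eqP; ring.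
Qed.

Lemma quotient_trace_diff k z : unit_disc z -> z != z1 ->
  @cdifferentiable R[i] (quotient_trace k) z.
Proof.
move=> hz nz; have dA := blaschke_path_diff hz.
have den0 := pseudohyp_denom_neq0 hz z1_lt1.
have num0 : z - z1 != 0 by rewrite subr_eq0.
apply: cdifferentiableM.
  by apply: cdifferentiable_tr; exact: mxdifferentiableX.
apply: cdifferentiableV; first by rewrite expf_neq0 // mulf_neq0 // invr_eq0.
apply: cdifferentiableX; apply: cdifferentiableM.
  apply: cdifferentiableB; first exact: cdifferentiable_id.
  exact: cdifferentiable_cst.
apply: cdifferentiableV => //.
apply: cdifferentiableB; first exact: cdifferentiable_cst.
apply: cdifferentiableM; first exact: cdifferentiable_cst.
exact: cdifferentiable_id.
Qed.

(** The maximum modulus principle for [quotient_trace] on a disc on whose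
    boundary the disc automorphism has modulus at least [1 - eta]. *)
Lemma trace_schwarz (z2 : R[i]) (eta : R) k : unit_disc z2 -> z2 != z1 ->
  0 < eta < 1 ->
  normc (\tr (blaschke_path z2 ^+ k.+1)) <=
    n.+1%:R * (pseudohyp z2 z1 / (1 - eta)) ^+ k.
Proof.
move=> hz2 nz heta; have [rho [rho0 rho1 z2rho Hrho]] :=
  pseudohyp_near_circle z1_lt1 heta hz2.
have disc z : normc z <= rho -> unit_disc z.
  by move=> h; apply: le_lt_trans rho1.
have eta0 : 0 < 1 - eta by lra.
have B0 : 0 <= n.+1%:R / (1 - eta) ^+ k by rewrite divr_ge0 ?exprn_ge0 ?ltW.
have p0 : 0 < pseudohyp z2 z1 by exact: pseudohyp_gt0.
suff : normc (quotient_trace k z2) <= n.+1%:R / (1 - eta) ^+ k.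
  rewrite /quotient_trace normcM normcV normcX -/(pseudohyp z2 z1).
  by rewrite ler_pdivrMr ?exprn_gt0 // expr_div_n mulrAC mulrA.
apply: (@maximum_modulus R _ rho) => // {hz2 nz p0 z2rho}.
- move=> z /disc hz.
  have [->|nz] := eqVneq z z1; first exact: quotient_trace_cont0.
  exact/cderiv_cont/cdifferentiable_cderiv/quotient_trace_diff.
- move=> z zrho Uz; have nz : z != z1.
    by apply: contraNneq Uz => ->; rewrite quotient_trace0.
  have nz0 : 0 < normc (z - z1) by rewrite normc_gt0 subr_eq0.
  exists (Num.min (rho - normc z) (normc (z - z1))).
    by rewrite lt_min subr_gt0 zrho.
  move=> w; rewrite lt_min => /andP[h1 h2].
  apply/cdifferentiable_cderiv/quotient_trace_diff.
    apply: disc; rewrite -[w](subrK z); apply: le_trans (ler_normcD _ _) _; lra.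
  by apply: contraTneq h2 => ->; rewrite normc_distC ltxx.
- move=> z zrho; have hz : unit_disc z by apply: disc; rewrite zrho.
  rewrite /quotient_trace normcM normcV normcX -/(pseudohyp z z1).
  apply: ler_pM; rewrite ?normc_ge0 ?invr_ge0 ?exprn_ge0 ?pseudohyp_ge0 //.
    exact: blaschke_path_trace_le.
  have hp := Hrho z zrho.
  rewrite lef_pV2 ?posrE ?exprn_gt0 //; last exact: lt_le_trans hp.
  by rewrite lerXn2r ?nnegrE ?pseudohyp_ge0 ?(ltW eta0).
Qed.

(** The Schwarz lemma for the spectral radius of [blaschke_path]: its
    eigenvalues at [z2] are the values of the Blaschke product at the
    eigenvalues of [F z2]. *)
Lemma blaschke_schwarz (z2 mu : R[i]) : unit_disc z2 -> eigenvalue (F z2) mu ->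
  \prod_(lam <- spectrum (F z1)) pseudohyp mu lam ^+ minpoly_mult (F z1) lam
  <= pseudohyp z2 z1.
Proof.
move=> hz2 hmu; have [z12|nz] := eqVneq z2 z1.
  (* Here [mu] is an eigenvalue of [F z1]: the factor at [lam = mu] is 0. *)
  rewrite z12 in hmu; apply: le_trans (pseudohyp_ge0 _ _).
  have muS : mu \in spectrum (F z1) by rewrite mem_spectrum.
  rewrite (big_fsetD1 mu) //= [X in X ^+ _](_ : _ = 0).
    by rewrite expr0n eqn0Ngt minpoly_mult_gt0 // mul0r.
  by rewrite /pseudohyp subrr mul0r normc0.
rewrite -normc_blaschke; have [t [t1 tE trE]] := blaschke_path_trace hz2.
have [i ->] := (tE mu).1 hmu.
pose b j := (blaschke_num (F z1)).[t j] / (blaschke_den (F z1)).[t j].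
rewrite -/(b i).
have b1 : normc (b i) <= 1.
  by apply: normc_blaschke_le1; [exact: F_ball|exact: t1].
have p0 : 0 < pseudohyp z2 z1 by exact: pseudohyp_gt0.
apply/ler_addgt0Pr => e e0; pose eta := Num.min e 1 / 2.
have [eta0 eta1 etae] : [/\ 0 < eta, eta < 1 & eta <= e].
  by rewrite /eta; case: (leP e 1) => ?; split; lra.
have eta'0 : 0 < 1 - eta by lra.
pose c := pseudohyp z2 z1 / (1 - eta).
have c0 : 0 < c by rewrite divr_gt0.
suff : normc (b i) <= c.
  rewrite ler_pdivlMr // mulrBr mulr1.
  have : normc (b i) * eta <= eta by rewrite ler_piMl // ltW.
  by lra.
(* The constant makes up for [trace_schwarz] having exponent [k], not [k.+1]. *)
apply: (@power_sums_bound R [seq b j | j <- enum 'I_n.+1] (n.+1%:R / c)) => //.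
  move=> k; rewrite big_map big_enum /= -(trE k.+1).
  rewrite (exprS c) mulrA divfK ?gt_eqF //.
  by apply: trace_schwarz => //; rewrite eta0.
by apply: map_f; rewrite mem_enum.
Qed.

End SchwarzPick.

Lemma bigmax_le_seq (R : realType) (T : eqType) (s : seq T) (f : T -> R)
    (M : R) :
  0 <= M -> (forall x, x \in s -> f x <= M) ->
  \big[Num.max/0]_(x <- s) f x <= M.
Proof.
move=> M0 H; rewrite big_seq; apply: (big_ind (fun y => y <= M)) => //.
by move=> x y hx hy; rewrite ge_max hx hy.
Qed.

Unset Implicit Arguments.

Theorem theorem1p5 (R : realType) (n : nat) (n_ge2 : (2 <= n.+1)%N)
  (F : R[i] -> 'M[R[i]]_n.+1)
  (F_ball : forall z : R[i], unit_disc z -> spectral_ball (F z))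
  (F_holo : holomorphic_on (@unit_disc R) F)
  (zeta1 zeta2 : R[i]) (hzeta1 : unit_disc zeta1) (hzeta2 : unit_disc zeta2) :
  let W1 := F zeta1 in
  let W2 := F zeta2 in
  Num.max
    (\big[Num.max/0]_(mu <- spectrum W2)
       \prod_(lam <- spectrum W1) pseudohyp mu lam ^+ minpoly_mult W1 lam)
    (\big[Num.max/0]_(lam <- spectrum W1)
       \prod_(mu <- spectrum W2) pseudohyp lam mu ^+ minpoly_mult W2 mu)
  <= pseudohyp zeta1 zeta2.
Proof.
cbv zeta; rewrite ge_max; apply/andP; split; apply: bigmax_le_seq.
- exact: pseudohyp_ge0.
- move=> mu; rewrite mem_spectrum pseudohypC => hmu.
  exact: blaschke_schwarz.
- exact: pseudohyp_ge0.
- move=> lam; rewrite mem_spectrum => hlam.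
  exact: blaschke_schwarz.
Qed.
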